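(* Let $X=\{X(t)\}_{t\in\mathbb{R}^m}$ be an operator self-similar random field with values in $\mathbb{R}^n$ and with range exponent $H\in M(n,\mathbb{R})$. Then for any domain exponent $E$, i.e. for any $E\in\mathcal{E}^{\mathrm{dom}}_H(X)$, we have $$\mathcal{E}^{\mathrm{dom}}_H(X)=E+T(G_1^{\mathrm{dom}}).$$ Moreover, there exists $E_0\in\mathcal{E}^{\mathrm{dom}}_H(X)$ such that $E_0B=BE_0$ for all $B\in G_1^{\mathrm{dom}}$. The nilpotent part of every $E\in\mathcal{E}^{\mathrm{dom}}_H(X)$ is the same, and it commutes with every element of $G_1^{\mathrm{dom}}$. Furthermore, every matrix $E\in\mathcal{E}^{\mathrm{dom}}_H(X)$ has the same real spectrum (real parts of the eigenvalues).
   Context: $M(p,\mathbb{R})$ is the space of real $p\times p$ matrices; for $c>0$ and a square matrix $M$, $c^M=\exp(M\log c)$. The symbol $\simeq$ denotes equality of all finite-dimensional distributions of random fields indexed by $t\in\mathbb{R}^m$. A random vector is full if its distribution is not supported on a lower dimensional (affine) hyperplane. A random field $X=\{X(t)\}_{t\in\mathbb{R}^m}$ with values in $\mathbb{R}^n$ is proper if $X(t)$ is full for all $t\neq 0$; it is degenerate if there is a projection $P\ne I$ on $\mathbb{R}^m$ ($P^2=P$ linear) with $X(t)=X(Pt)$ for all $t$, and nondegenerate otherwise; it is stochastically continuous if $X(t_k)\to X(t)$ in probability whenever $t_k\to t$. A proper, nondegenerate, stochastically continuous field $X$ is operator self-similar (o.s.s., or $(E,H)$-o.s.s.) if for some $E\in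 M(m,\mathbb{R})$, $H\in M(n,\mathbb{R})$, $$\{X(c^Et)\}_{t\in\mathbb{R}^m}\simeq\{c^HX(t)\}_{t\in\mathbb{R}^m}\quad\text{for all }c>0.\qquad( * )$$ Standing assumption: all eigenvalues of $E$ and $H$ have strictly positive real parts (which implies $X(0)=0$ a.s.). $E$ is called a domain exponent and $H$ a range exponent. Given a range exponent $H$, $\mathcal{E}^{\mathrm{dom}}_H(X)$ is the set of all $E\in M(m,\mathbb{R})$ such that $( * )$ holds. The domain symmetries are $G_1^{\mathrm{dom}}=\{A\in M(m,\mathbb{R}): X(At)\simeq X(t)\}$ (a compact subgroup of $GL(m,\mathbb{R})$). For a closed group $\mathcal{G}\subseteq GL(k,\mathbb{R})$, its tangent space is $$T(\mathcal{G})=\Big\{A\in M(k,\mathbb{R}): A=\lim_{j\to\infty}\frac{G_j-I}{d_j}\text{ for some }\{G_j\}\subseteq\mathcal{G}\text{ and some real }0\neq d_j\to0\Big\}.$$ The nilpotent part of a matrix $E$ is the matrix $N$ in its additive Jordan decomposition $E=S+N$, with $S$ semisimple (diagonalizable over $\mathbb{C}$), $N$ nilpotent and $SN=NS$. *)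

(* Defs.v *)
From mathcomp Require Export all_boot all_order all_algebra.
From mathcomp Require Export complex.
From mathcomp Require Export all_classical all_reals all_analysis.

Set Implicit Arguments.
Unset Strict Implicit.
Unset Printing Implicit Defensive.

Import Order.TTheory GRing.Theory Num.Theory numFieldNormedType.Exports.
Local Open Scope classical_set_scope.
Local Open Scope ring_scope.

Section Matrices.
Variable R : realType.
Implicit Types p : nat.

Definition expmx p (A : 'M[R]_p) : 'M[R]_p :=
  lim (series (fun k : nat => (k`!%:R)^-1 *: (A ^+ k)) @ \oo).

Definition powmx p (c : R) (M : 'M[R]_p) : 'M[R]_p := expmx (ln c *: M).

Definition complexmx p (M : 'M[R]_p) : 'M[R[i]]_p := map_mx (real_complex R) M.

(* Set of real parts, without multiplicities. *)
Definition real_spectrum p (M : 'M[R]_p) : set R :=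
  [set complex.Re z | z in [set z : R[i] | eigenvalue (complexmx M) z]].

Definition semisimplemx p (S : 'M[R]_p) : Prop := diagonalizable (complexmx S).

Definition nilpotentmx p (N : 'M[R]_p) : Prop := exists k : nat, N ^+ k = 0.

(* The set of all N occurring in an additive Jordan decomposition M = S + N:
   "N is the nilpotent part of M" reads [nilpotent_part M = [set N]]. *)
Definition nilpotent_part p (M : 'M[R]_p) : set 'M[R]_p :=
  [set N | exists S : 'M[R]_p,
    [/\ M = S + N, semisimplemx S, nilpotentmx N & S *m N = N *m S]].

Definition tangent_space p (G : set 'M[R]_p) : set 'M[R]_p :=
  [set A | exists (g : nat -> 'M[R]_p) (d : nat -> R),
    [/\ forall j, G (g j),
        forall j, d j != 0,
        d @ \oo --> (0 : R) &
        (fun j => (d j)^-1 *: (g j - 1%:M)) @ \oo --> A]].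

Definition mxborel (m n : nat) : set (set 'M[R]_(m, n)) :=
  <<s [set U : set 'M[R]_(m, n) | open U] >>.

End Matrices.

Section RandomFields.
Variables (R : realType) (d : measure_display) (T : measurableType d).
Variables (P : probability T R) (m n : nat).
Implicit Types (Y : T -> 'cV[R]_n) (X Z : 'cV[R]_m -> T -> 'cV[R]_n).

Definition random_vector Y : Prop :=
  forall B, mxborel B -> measurable (Y @^-1` B).

Definition random_field X : Prop := forall t, random_vector (X t).

(* Equality of the joint laws of (X(t_1), ..., X(t_k)) and (Z(t_1), ..., Z(t_k)),
   where k vectors of R^n are the columns of an n x k matrix. *)
Definition fdd_eq X Z : Prop :=
  forall (k : nat) (t : 'I_k -> 'cV[R]_m) (B : set 'M[R]_(n, k)), mxborel B ->
    P [set w | B (\matrix_(i, j) X (t j) w i 0)] =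
    P [set w | B (\matrix_(i, j) Z (t j) w i 0)].

Definition full_vector Y : Prop :=
  forall (a : 'rV[R]_n) (b : R), a != 0 ->
    P [set w | (a *m Y w) 0 0 = b] <> 1%E.

Definition proper_field X : Prop := forall t, t != 0 -> full_vector (X t).

(* The equality X(t) = X(Qt) of random vectors is almost sure. *)
Definition degenerate X : Prop :=
  exists Q : 'M[R]_m, [/\ Q *m Q = Q, Q <> 1%:M &
    forall t, {ae P, forall w, X t w = X (Q *m t) w}].

Definition stochastically_continuous X : Prop :=
  forall (t : 'cV[R]_m) (u : nat -> 'cV[R]_m), u @ \oo --> t ->
  forall e : R, 0 < e ->
    (fun k => P [set w | e <= `|X (u k) w - X t w|]) @ \oo --> (0 : \bar R)%E.

Definition self_similar X (E : 'M[R]_m) (H : 'M[R]_n) : Prop :=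
  forall c : R, 0 < c ->
    fdd_eq (fun t => X (powmx c E *m t)) (fun t w => powmx c H *m X t w).

Definition oss X (E : 'M[R]_m) (H : 'M[R]_n) : Prop :=
  [/\ random_field X, proper_field X, ~ degenerate X & stochastically_continuous X] /\
  [/\ (forall x, real_spectrum E x -> 0 < x),
      (forall x, real_spectrum H x -> 0 < x) & self_similar X E H].

Definition domain_exponents X (H : 'M[R]_n) : set 'M[R]_m :=
  [set E | self_similar X E H].

Definition domain_symmetries X : set 'M[R]_m :=
  [set A | fdd_eq (fun t => X (A *m t)) X].

End RandomFields.

(* Main.v *)
Require Import Defs.
From mathcomp Require Import separable.
From mathcomp Require Import ring lra.

Set Implicit Arguments.
Unset Strict Implicit.
Unset Printing Implicit Defensive.

Import Order.TTheory GRing.Theory Num.Theory numFieldNormedType.Exports.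
Local Open Scope classical_set_scope.
Local Open Scope ring_scope.

(** Write [F s] for the set of the matrices [B] such that the field [X (B t)] has
    the law of [exp (s H) X t].  The theorem is a statement about the group formed
    by the pairs [(s, B)] with [B] in [F s]: its part [F 0] is the group of domain
    symmetries, and [E] is a domain exponent exactly when [exp (s E)] lies in [F s]
    for all real [s].

    Three facts about this group come from the field.  Its elements are invertible,
    because a singular [B] factors through a projection, through which [X] would
    then factor too ([scaling_group_graded]).  It is closed, because stochastic
    continuity turns convergence of matrices into convergence in probability, and
    equality of laws passes to such limits ([law_eq_limit]).  Finally [F 0] is
    bounded ([domain_symmetries_bounded]): otherwise some symmetries would send
    points [t j] of the unit ball to points [exp (s j E) v j] with [v j] on the unit
    sphere and [s j] tending to infinity, and then [X (v j)], which has the law of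
    [exp (- s j H) X (t j)], would tend to 0, against properness.  The spectral
    hypotheses serve here, through the decay of [exp (- s H)] ([expmx_decay]).

    The rest is Lie theory for a closed group graded by the reals.  If elements [B]
    of [F s], with [s] small, agree with [1 + s M] to first order, then large powers
    of them approach [exp (s M)], so that [M] is an exponent ([graded_exp]).  Hence
    exponents differ by elements of the tangent space of [F 0], adding such an
    element to an exponent gives an exponent, and the set of exponents is closed,
    convex and stable under conjugation by [F 0].

    A bounded group of linear maps that acts on a closed convex set has a fixed
    point there, namely the minimiser of the supremum of the Frobenius norm over
    orbits ([fixed_point_exists]); this takes the place of averaging against Haar
    measure.  Applied to conjugation on exponents, it gives an exponent [E0] that
    commutes with [F 0].  Applied to congruence on bilinear forms, it gives a
    positive definite form that is invariant under [F 0].  The tangent matrices of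
    [F 0] are skew for this form, hence semisimple with imaginary eigenvalues.

    Every exponent is therefore [E0 + A] with [A] semisimple, of imaginary spectrum,
    and commuting with [E0].  If [E0 = S + N] is the Jordan decomposition, then that
    of [E0 + A] is [(S + A) + N], and the eigenvalues of [E0 + A] have the same real
    parts as those of [E0].  As [N] is a polynomial in [E0], it commutes with
    [F 0]. *)

(** * The row-sum norm *)

Section RowSumNorm.
Variable R : realType.

(** The operator norm for the sup norms on columns.  Unlike the entrywise maximum
    it is submultiplicative; it defines the same topology, by [cvg_opnP]. *)
Definition opn m n (A : 'M[R]_(m, n)) : R :=
  \big[Num.max/0]_i \sum_j `|A i j|.

Lemma opn_ge0 m n (A : 'M[R]_(m, n)) : 0 <= opn A.
Proof. exact: bigmax_ge_id. Qed.

Lemma row_sum_le_opn m n (A : 'M[R]_(m, n)) i : \sum_j `|A i j| <= opn A.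
Proof. exact: le_bigmax. Qed.

Lemma opn_le m n (A : 'M[R]_(m, n)) c :
  0 <= c -> (forall i, \sum_j `|A i j| <= c) -> opn A <= c.
Proof. by move=> c0 h; apply/bigmax_leP. Qed.

Lemma entry_le_opn m n (A : 'M[R]_(m, n)) i j : `|A i j| <= opn A.
Proof.
apply: le_trans (row_sum_le_opn A i).
by rewrite (bigD1 j) //= lerDl sumr_ge0.
Qed.

Lemma norm_le m n (A : 'M[R]_(m, n)) (c : R) :
  0 <= c -> (forall i j, `|A i j| <= c) -> `|A| <= c.
Proof.
move=> c0 h; rewrite /Num.norm /= mx_normrE.
by apply/bigmax_leP; split => // -[i j] _; exact: h.
Qed.

Lemma entry_le_norm m n (A : 'M[R]_(m, n)) i j : `|A i j| <= `|A|.
Proof.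
rewrite [leRHS]/Num.norm /= mx_normrE.
exact: (le_bigmax _ (fun ij : 'I_m * 'I_n => `|A ij.1 ij.2|) (i, j)).
Qed.

Lemma norm_le_opn m n (A : 'M[R]_(m, n)) : `|A| <= opn A.
Proof. by apply: norm_le => [|i j]; [exact: opn_ge0 | exact: entry_le_opn]. Qed.

Lemma opn_le_norm m n (A : 'M[R]_(m, n)) : opn A <= n%:R * `|A|.
Proof.
apply: opn_le => [|i]; first by rewrite mulr_ge0.
apply: (@le_trans _ _ (\sum_(j < n) `|A|)).
  by apply: ler_sum => j _; exact: entry_le_norm.
by rewrite sumr_const card_ord mulr_natl.
Qed.

Lemma opn0 m n : opn (0 : 'M[R]_(m, n)) = 0.
Proof.
apply/eqP; rewrite eq_le opn_ge0 andbT; apply: opn_le => // i.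
by rewrite big1 // => j _; rewrite mxE normr0.
Qed.

Lemma opnN m n (A : 'M[R]_(m, n)) : opn (- A) = opn A.
Proof.
by apply: eq_bigr => i _; apply: eq_bigr => j _; rewrite mxE normrN.
Qed.

Lemma opnD m n (A B : 'M[R]_(m, n)) : opn (A + B) <= opn A + opn B.
Proof.
apply: opn_le => [|i]; first by rewrite addr_ge0 ?opn_ge0.
apply: le_trans (lerD (row_sum_le_opn A i) (row_sum_le_opn B i)).
by rewrite -big_split; apply: ler_sum => j _; rewrite mxE ler_normD.
Qed.

Lemma opnB m n (A B : 'M[R]_(m, n)) : opn (A - B) <= opn A + opn B.
Proof. by rewrite -(opnN B) opnD. Qed.

Lemma opnC m n (A B : 'M[R]_(m, n)) : opn (A - B) = opn (B - A).
Proof. by rewrite -opnN opprB. Qed.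

Lemma opnZ m n c (A : 'M[R]_(m, n)) : opn (c *: A) <= `|c| * opn A.
Proof.
apply: opn_le => [|i]; first by rewrite mulr_ge0 ?opn_ge0.
apply: (@le_trans _ _ (`|c| * \sum_j `|A i j|)).
  by rewrite mulr_sumr; apply: ler_sum => j _; rewrite mxE normrM.
by rewrite ler_wpM2l ?row_sum_le_opn.
Qed.

Lemma opn_sum m n (I : Type) (r : seq I) (Q : pred I) (F : I -> 'M[R]_(m, n)) :
  opn (\sum_(i <- r | Q i) F i) <= \sum_(i <- r | Q i) opn (F i).
Proof.
elim/big_ind2 : _ => [|x a y b xa yb|//]; first by rewrite opn0.
exact: le_trans (opnD _ _) (lerD xa yb).
Qed.

Lemma opnM m n p (A : 'M[R]_(m, n)) (B : 'M[R]_(n, p)) :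
  opn (A *m B) <= opn A * opn B.
Proof.
apply: opn_le => [|i]; first by rewrite mulr_ge0 ?opn_ge0.
apply: (@le_trans _ _ (\sum_k `|A i k| * opn B)); last first.
  by rewrite -mulr_suml ler_wpM2r ?opn_ge0 ?row_sum_le_opn.
apply: (@le_trans _ _ (\sum_j \sum_k `|A i k| * `|B k j|)).
  apply: ler_sum => j _; rewrite mxE (le_trans (ler_norm_sum _ _ _)) //.
  by apply: ler_sum => k _; rewrite normrM.
rewrite exchange_big; apply: ler_sum => k _ /=.
by rewrite -mulr_sumr ler_wpM2l ?row_sum_le_opn.
Qed.

Lemma norm_mulmx_le m n p (A : 'M[R]_(m, n)) (B : 'M[R]_(n, p)) :
  `|A *m B| <= opn A * `|B|.
Proof.
apply: norm_le => [|i j]; first by rewrite mulr_ge0 ?opn_ge0.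
apply: (@le_trans _ _ (\sum_k `|A i k| * `|B|)); last first.
  by rewrite -mulr_suml ler_wpM2r ?row_sum_le_opn.
rewrite mxE (le_trans (ler_norm_sum _ _ _)) //.
by apply: ler_sum => k _; rewrite normrM ler_wpM2l ?entry_le_norm.
Qed.

Lemma opn1 p : opn (1 : 'M[R]_p) <= 1.
Proof.
apply: opn_le => // i; rewrite (bigD1 i) //= big1 ?addr0.
  by rewrite mxE eqxx normr1.
by move=> j ji; rewrite mxE eq_sym (negbTE ji) normr0.
Qed.

Lemma opnX p (A : 'M[R]_p) k : opn (A ^+ k) <= opn A ^+ k.
Proof.
elim: k => [|k ih]; first by rewrite !expr0 opn1.
by rewrite !exprS (le_trans (opnM _ _)) // ler_wpM2l ?opn_ge0.
Qed.

Lemma cvg_opnP m n (u : nat -> 'M[R]_(m, n)) (A : 'M[R]_(m, n)) :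
  (u @ \oo --> A) <-> (forall e, 0 < e -> \forall k \near \oo, opn (u k - A) < e).
Proof.
split=> [/cvgr_distC_lt h e e0|h].
  have d0 : 0 < e / (n%:R + 1) by rewrite divr_gt0 // ltr_wpDl.
  have := h _ d0; apply: filterS => k hk.
  apply: (le_lt_trans (opn_le_norm _)).
  apply: (@le_lt_trans _ _ (n%:R * (e / (n%:R + 1)))).
    by rewrite ler_wpM2l // ltW.
  by rewrite mulrCA gtr_pMr // ltr_pdivrMr ?ltr_wpDl // mul1r ltrDl.
apply/cvgrPdistC_lt => e e0; have := h _ e0; apply: filterS => k hk.
exact: le_lt_trans (norm_le_opn _) hk.
Qed.

Lemma continuous_mulmxl m n p (L : 'M[R]_(m, n)) :
  continuous (fun M : 'M[R]_(n, p) => L *m M).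
Proof.
move=> M; have FM : Filter (nbhs M) by exact: nbhs_filter.
apply/(@cvgrPdist_le _ _ _ (nbhs M)) => e e0.
have d0 : 0 < e / (opn L + 1) by rewrite divr_gt0 // ltr_wpDl ?opn_ge0.
have := @nbhsx_ballx R 'M[R]_(n, p) M _ d0; apply: (@filterS _ (nbhs M) FM) => N.
rewrite -ball_normE /= => /ltW MN.
rewrite -mulmxBr (le_trans (norm_mulmx_le _ _)) //.
apply: (@le_trans _ _ (opn L * (e / (opn L + 1)))).
  by rewrite ler_wpM2l ?opn_ge0.
rewrite mulrCA ger_pMr // ler_pdivrMr ?ltr_wpDl ?opn_ge0 //.
by rewrite mul1r lerDl.
Qed.

(** By telescoping; used to turn agreement to first order at the unit into
    closeness of long products. *)
Lemma opn_expB p (A B : 'M[R]_p) (c : R) n : opn A <= c -> opn B <= c ->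
  opn (A ^+ n - B ^+ n) <= n%:R * c ^+ n.-1 * opn (A - B).
Proof.
move=> Ac Bc; have c0 : 0 <= c := le_trans (opn_ge0 A) Ac.
elim: n => [|n ih]; first by rewrite !expr0 subrr opn0 !mul0r.
have -> : A ^+ n.+1 - B ^+ n.+1 = A * (A ^+ n - B ^+ n) + (A - B) * B ^+ n.
  by rewrite mulrBr mulrBl -!exprS addrA subrK.
rewrite (le_trans (opnD _ _)) //.
rewrite [leRHS](_ : _ = n%:R * c ^+ n * opn (A - B) + c ^+ n * opn (A - B)).
  apply: lerD; last first.
    rewrite (le_trans (opnM _ _)) // mulrC ler_wpM2r ?opn_ge0 //.
    by rewrite (le_trans (opnX _ _)) // lerXn2r ?nnegrE ?opn_ge0.
  rewrite (le_trans (opnM _ _)) //.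
  apply: (@le_trans _ _ (c * (n%:R * c ^+ n.-1 * opn (A - B)))).
    by rewrite ler_pM ?opn_ge0.
  case: n {ih} => [|n] /=; first by rewrite !mul0r mulr0.
  by rewrite exprS !mulrA [c * _]mulrC.
by rewrite -natr1 /=; ring.
Qed.

End RowSumNorm.

(** * The matrix exponential *)

Section CauchyProduct.

(** The remainder of the Cauchy product of two partial sums, as one sum, so that
    it can be estimated termwise. *)
Lemma square_sub_triangle (V : zmodType) (f : nat -> nat -> V) n :
  \sum_(0 <= i < n) \sum_(0 <= j < n) f j i
  - \sum_(0 <= k < n) \sum_(0 <= i < k.+1) f (k - i)%N i
  = \sum_(0 <= i < n) \sum_(n - i <= j < n) f j i.
Proof.
have -> : \sum_(0 <= k < n) \sum_(0 <= i < k.+1) f (k - i)%N i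
        = \sum_(0 <= i < n) \sum_(0 <= j < n - i) f j i.
  transitivity (\sum_(0 <= k < n) \sum_(0 <= i < n | (i < k.+1)%N) f (k - i)%N i).
    by apply: eq_big_nat => k /andP[_ kn]; rewrite (big_nat_widen _ _ n).
  rewrite (exchange_big_dep_nat xpredT) //=.
  apply: eq_big_nat => i /andP[_ ilt].
  rewrite [RHS](_ : _ = \sum_(0 + i <= k < n) f (k - i)%N i); last first.
    by rewrite big_addn; apply: eq_bigr => j _; rewrite addnK.
  rewrite /= add0n [RHS](big_nat_widenl _ 0) //.
rewrite -sumrB; apply: eq_big_nat => i /andP[_ ilt].
rewrite (@big_cat_nat _ _ _ (n - i)%N) ?leq_subr //=.
by rewrite addrAC subrr add0r.
Qed.

End CauchyProduct.

Section Exponential.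
Variable R : realType.

Definition exp_psum p n (A : 'M[R]_p) : 'M[R]_p :=
  \sum_(0 <= k < n) (k`!%:R)^-1 *: A ^+ k.

Lemma scalemx_mul p (a b : R) (A B : 'M[R]_p) :
  (a *: A) * (b *: B) = (a * b) *: (A * B).
Proof. by rewrite -[LHS]/(_ *m _) -scalemxAl -scalemxAr scalerA. Qed.

Lemma opn_cauchy_cvg m n (u : nat -> 'M[R]_(m, n)) :
  (forall e, 0 < e -> exists N, forall k l, (N <= k)%N -> (N <= l)%N ->
     opn (u k - u l) < e) ->
  exists A : 'M[R]_(m, n), u @ \oo --> A.
Proof.
move=> h; apply/cvg_ex; apply: cauchy_cvg; apply: cauchy_exP => e e0.
have [N hN] := h e e0; exists (u N), N => // k /= Nk.
rewrite -ball_normE /=; apply: le_lt_trans (norm_le_opn _) _.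
exact: hN.
Qed.

Lemma cvg_expR_psum (a : R) : series (exp_coeff a) @ \oo --> expR a.
Proof. exact: is_cvg_series_exp_coeff. Qed.

Lemma opn_psum_tail p (A : 'M[R]_p) k l : (k <= l)%N ->
  opn (exp_psum l A - exp_psum k A)
  <= series (exp_coeff (opn A)) l - series (exp_coeff (opn A)) k.
Proof.
move=> kl; rewrite /exp_psum /series /=.
rewrite (@big_cat_nat _ _ _ k 0 l) //= [X in _ <= X - _](@big_cat_nat _ _ _ k 0 l) //=.
rewrite addrAC subrr add0r [leRHS]addrAC subrr add0r.
apply: le_trans (opn_sum _ _ _) _; apply: ler_sum => i _.
apply: le_trans (opnZ _ _) _.
rewrite ger0_norm ?invr_ge0 // mulrC ler_wpM2r ?invr_ge0 //.
exact: opnX.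
Qed.

Lemma cvg_exp_psum p (A : 'M[R]_p) : (fun n => exp_psum n A) @ \oo --> expmx A.
Proof.
suff /cvg_ex h : exists B : 'M[R]_p, (fun n => exp_psum n A) @ \oo --> B by exact: h.
apply: opn_cauchy_cvg => e e0.
have /cvg_cauchy/cauchy_ballP/(_ _ e0) := is_cvg_series_exp_coeff (opn A).
move=> [[P Q]] [[N1 _ P1] [N2 _ Q2]] PQ.
exists (maxn N1 N2) => k l; rewrite !geq_max => /andP[k1 k2] /andP[l1 l2].
wlog kl : k l k1 k2 l1 l2 / (k <= l)%N.
  move=> h; have [kl|/ltnW lk] := leqP k l; first exact: h.
  by rewrite opnC; exact: h.
rewrite opnC; apply: le_lt_trans (opn_psum_tail _ kl) _.
have := PQ (series (exp_coeff (opn A)) k, series (exp_coeff (opn A)) l).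
move=> /(_ (conj (P1 k k1) (Q2 l l2))); rewrite /ball /= distrC.
exact: le_lt_trans (ler_norm _).
Qed.

Lemma opn_lim_le m n (u : nat -> 'M[R]_(m, n)) (v : nat -> R)
    (A B : 'M[R]_(m, n)) (b : R) :
  u @ \oo --> B -> v @ \oo --> b ->
  (\forall k \near \oo, opn (u k - A) <= v k) -> opn (B - A) <= b.
Proof.
move=> /cvg_opnP uB vb h; apply/ler_addgt0Pr => e e0.
have e20 : 0 < e / 2 by rewrite divr_gt0.
have [k [h1 h2 h3]] : exists k, [/\ opn (u k - A) <= v k, opn (u k - B) < e / 2
     & `|v k - b| < e / 2].
  move: vb => /cvgr_distC_lt/(_ _ e20) vb'; near \oo => k; exists k; split; near: k.
  - exact: h.
  - exact: uB.
  - exact: vb'.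
have -> : B - A = (u k - A) - (u k - B) by rewrite opprB [RHS]addrC subrKA.
apply: le_trans (opnB _ _) _.
have := ler_norm (v k - b); lra.
Unshelve. all: by end_near. Qed.

(** Domination by the scalar series at [opn A]; the bounds on [expmx] below are
    the cases [n = 0], [n = 1] and [n = 2]. *)
Lemma opn_exp_tail p (A : 'M[R]_p) n :
  opn (expmx A - exp_psum n A) <= expR (opn A) - series (exp_coeff (opn A)) n.
Proof.
apply: (@opn_lim_le _ _ _ (fun l => series (exp_coeff (opn A)) l
  - series (exp_coeff (opn A)) n) _ _ _ (@cvg_exp_psum p A)).
  by apply: cvgB; [exact: cvg_expR_psum | exact: cvg_cst].
by exists n => // k /= nk; exact: opn_psum_tail.
Qed.

Lemma opn_expmx p (A : 'M[R]_p) : opn (expmx A) <= expR (opn A).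
Proof.
by have := opn_exp_tail A 0; rewrite /exp_psum /series /= !big_geq // !subr0.
Qed.

Lemma expR_sub1_le (a : R) : expR a - 1 <= a * expR a.
Proof.
have := expR_ge1Dx (- a); rewrite -(@ler_pM2r _ (expR a)) ?expR_gt0 //.
by rewrite -expRD addNr expR0; lra.
Qed.

Lemma opn_expmx_sub1 p (A : 'M[R]_p) : opn (expmx A - 1) <= opn A * expR (opn A).
Proof.
have := opn_exp_tail A 1; rewrite /exp_psum /series /= !big_nat1.
rewrite /exp_coeff /= !expr0 fact0 invr1 scale1r mulr1 => h.
exact: le_trans h (expR_sub1_le _).
Qed.

Lemma opn_expmx_sub1D p (A : 'M[R]_p) :
  opn (expmx A - 1 - A) <= opn A ^+ 2 * expR (opn A).
Proof.
have := opn_exp_tail A 2; rewrite /exp_psum /series /= !big_nat_recr //= !big_geq //.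
rewrite /exp_coeff /= !expr0 !expr1 fact0 factE /= !invr1 !scale1r !mulr1 !add0r.
rewrite opprD addrA => /le_trans; apply.
have a0 := opn_ge0 A; have h := expR_sub1_le (opn A).
have := ler_wpM2l a0 h; rewrite expr2; lra.
Qed.

Lemma expmx0 p : expmx (0 : 'M[R]_p) = 1.
Proof.
apply/eqP; rewrite -subr_eq0; apply/eqP.
have := opn_expmx_sub1 (0 : 'M[R]_p); rewrite opn0 mul0r => h.
apply/matrixP => i j; apply/eqP; rewrite [X in _ == X]mxE -normr_le0.
exact: le_trans (entry_le_opn _ i j) h.
Qed.

Lemma exp_psum_cauchy p (A B : 'M[R]_p) n : GRing.comm A B ->
  opn (exp_psum n A * exp_psum n B - exp_psum n (A + B)) <=
  series (exp_coeff (opn A)) n * series (exp_coeff (opn B)) n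
  - series (exp_coeff (opn A + opn B)) n.
Proof.
move=> cAB.
have bin_inv k i : (i < k.+1)%N ->
   (k`!%:R)^-1 *+ 'C(k, i) = ((k - i)`!%:R)^-1 * (i`!%:R)^-1 :> R.
  rewrite ltnS => ik; rewrite -mulr_natr -(bin_fact ik) !natrM.
  have c0 : ('C(k, i)%:R : R) != 0 by rewrite pnatr_eq0 -lt0n bin_gt0.
  have i0 : (i`!%:R : R) != 0 by rewrite pnatr_eq0 -lt0n fact_gt0.
  have ki0 : ((k - i)`!%:R : R) != 0 by rewrite pnatr_eq0 -lt0n fact_gt0.
  by field; rewrite c0 i0 ki0.
have -> : exp_psum n A * exp_psum n B - exp_psum n (A + B) =
  \sum_(0 <= i < n) \sum_(n - i <= j < n)
     ((j`!%:R)^-1 *: A ^+ j) * ((i`!%:R)^-1 *: B ^+ i).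
  rewrite -(square_sub_triangle
     (fun j i => ((j`!%:R)^-1 *: A ^+ j) * ((i`!%:R)^-1 *: B ^+ i))).
  congr (_ - _).
    rewrite exchange_big /= /exp_psum mulr_suml; apply: eq_bigr => i _.
    by rewrite mulr_sumr.
  apply: eq_bigr => k _; rewrite exprDn_comm // big_mkord scaler_sumr.
  apply: eq_bigr => i _.
  by rewrite scalemx_mul -bin_inv // -scalerMnl scalerMnr.
have -> : series (exp_coeff (opn A)) n * series (exp_coeff (opn B)) n
  - series (exp_coeff (opn A + opn B)) n =
  \sum_(0 <= i < n) \sum_(n - i <= j < n)
     exp_coeff (opn A) j * exp_coeff (opn B) i.
  rewrite -(square_sub_triangle (fun j i => exp_coeff (opn A) j * exp_coeff (opn B) i)).
  rewrite /series /=; congr (_ - _).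
    rewrite exchange_big /= mulr_suml; apply: eq_bigr => i _.
    by rewrite mulr_sumr.
  apply: eq_bigr => k _; rewrite /exp_coeff /= exprDn_comm; last exact: mulrC.
  rewrite big_mkord mulr_suml.
  apply: eq_bigr => i _.
  rewrite mulrnAl -mulrnAr bin_inv //; ring.
apply: le_trans (opn_sum _ _ _) _; apply: ler_sum => i _.
apply: le_trans (opn_sum _ _ _) _; apply: ler_sum => j _.
apply: le_trans (opnM _ _) _.
have term (C : 'M[R]_p) k : opn ((k`!%:R)^-1 *: C ^+ k) <= exp_coeff (opn C) k.
  apply: le_trans (opnZ _ _) _; rewrite /exp_coeff /= mulrC.
  by rewrite ger0_norm ?invr_ge0 // ler_wpM2r ?invr_ge0 // opnX.
by apply: ler_pM => //; exact: opn_ge0.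
Qed.

(** Domination by the scalar exponential series of the norms: the defect of
    multiplicativity of the partial sums is bounded by the same defect for the
    scalars [opn A] and [opn B], which tends to 0 by [expRD]. *)
Lemma expmxD p (A B : 'M[R]_p) : GRing.comm A B ->
  expmx (A + B) = expmx A * expmx B.
Proof.
move=> cAB; set a := opn A; set b := opn B.
suff h : opn (expmx (A + B) - expmx A * expmx B) <= 0.
  apply/eqP; rewrite -subr_eq0; apply/eqP; apply/matrixP => i j.
  apply/eqP; rewrite [X in _ == X]mxE -normr_le0.
  exact: le_trans (entry_le_opn _ i j) h.
pose v n := (series (exp_coeff a) n * series (exp_coeff b) n
                 - series (exp_coeff (a + b)) n)
   + (expR a * (expR b - series (exp_coeff b) n)
      + (expR a - series (exp_coeff a) n) * expR b).
have v0 : v @ \oo --> (0 : R).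
  have -> : 0 = (expR a * expR b - expR (a + b)) + (expR a * (expR b - expR b)
      + (expR a - expR a) * expR b) by rewrite expRD; ring.
  have ca := @cvg_expR_psum a; have cb := @cvg_expR_psum b.
  apply: cvgD; first by apply: cvgB (@cvg_expR_psum _); apply: cvgM.
  apply: cvgD; apply: cvgM => //; try exact: cvg_cst.
    by apply: cvgB => //; exact: cvg_cst.
  by apply: cvgB => //; exact: cvg_cst.
apply: (opn_lim_le (@cvg_exp_psum p (A + B)) v0); near=> n.
have -> : exp_psum n (A + B) - expmx A * expmx B =
  - (exp_psum n A * exp_psum n B - exp_psum n (A + B))
  - (exp_psum n A * (expmx B - exp_psum n B) + (expmx A - exp_psum n A) * expmx B).
  by rewrite mulrBr mulrBl [X in _ = _ - X]addrC subrKA !opprB subrKA.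
apply: le_trans (opnB _ _) _; rewrite opnN; apply: lerD.
  exact: exp_psum_cauchy.
apply: le_trans (opnD _ _) _; apply: lerD; apply: le_trans (opnM _ _) _.
  apply: ler_pM; rewrite ?opn_ge0 //; last exact: opn_exp_tail.
  have := opn_psum_tail A (leq0n n).
  rewrite /exp_psum [X in series _ _ - X]/series /= !(big_geq (leqnn 0)) !subr0.
  move=> /le_trans; apply; apply: nondecreasing_cvgn_le.
    apply: nondecreasing_series => k _ _.
    by rewrite /exp_coeff /= divr_ge0 // exprn_ge0 // opn_ge0.
  exact: is_cvg_series_exp_coeff.
apply: ler_pM; rewrite ?opn_ge0 ?opn_expmx //; exact: opn_exp_tail.
Unshelve. all: by end_near. Qed.

Lemma expmx_scaleD p (A : 'M[R]_p) s t :
  expmx ((s + t) *: A) = expmx (s *: A) * expmx (t *: A).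
Proof.
rewrite scalerDl expmxD // /GRing.comm.
by rewrite !scalemx_mul mulrC.
Qed.

Lemma expmx_scaleNK p (A : 'M[R]_p) s : expmx (- s *: A) * expmx (s *: A) = 1.
Proof. by rewrite -expmx_scaleD addNr scale0r expmx0. Qed.

Lemma expmx_scaleKN p (A : 'M[R]_p) s : expmx (s *: A) * expmx (- s *: A) = 1.
Proof. by rewrite -expmx_scaleD addrN scale0r expmx0. Qed.

Lemma expmx_comm p (A B : 'M[R]_p) : GRing.comm A B -> GRing.comm (expmx A) B.
Proof.
move=> cAB; apply/eqP; rewrite -subr_eq0; apply/eqP/matrixP => i j.
apply/eqP; rewrite [X in _ == X]mxE -normr_le0.
apply: le_trans (entry_le_opn _ i j) _; apply/ler_addgt0Pr => e e0; rewrite add0r.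
have d0 : 0 < e / (2 * opn B + 1) by rewrite divr_gt0 // ltr_wpDl // mulr_ge0 ?opn_ge0.
have /cvg_opnP/(_ _ d0)[N _ /(_ N (leqnn N)) /= hN] := @cvg_exp_psum p A.
have cS : exp_psum N A * B = B * exp_psum N A.
  rewrite /exp_psum mulr_suml mulr_sumr; apply: eq_bigr => k _.
  have -> : ((k`!%:R)^-1 *: A ^+ k) * B = (k`!%:R)^-1 *: (A ^+ k * B).
    by rewrite -[B in LHS]scale1r scalemx_mul mulr1.
  have -> : B * ((k`!%:R)^-1 *: A ^+ k) = (k`!%:R)^-1 *: (B * A ^+ k).
    by rewrite -[B in LHS]scale1r scalemx_mul mul1r.
  by rewrite (commrX k (commr_sym cAB)).
have -> : expmx A * B - B * expmx A =
    B * (exp_psum N A - expmx A) - (exp_psum N A - expmx A) * B.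
  by rewrite mulrBr mulrBl cS opprB [RHS]addrC subrKA.
move: hN; rewrite ltr_pdivlMr ?ltr_wpDl ?mulr_ge0 ?opn_ge0 // => hN.
have := opnB (B * (exp_psum N A - expmx A)) ((exp_psum N A - expmx A) * B).
have := opnM B (exp_psum N A - expmx A).
have := opnM (exp_psum N A - expmx A) B.
have := opn_ge0 (exp_psum N A - expmx A).
set x := opn (exp_psum N A - expmx A); rewrite -/x in hN *; lra.
Qed.

Lemma expmx_scaleX p (A : 'M[R]_p) s n :
  expmx ((n%:R * s) *: A) = expmx (s *: A) ^+ n.
Proof.
elim: n => [|n ih]; first by rewrite mul0r scale0r expmx0 expr0.
by rewrite -natr1 mulrDl mul1r expmx_scaleD ih exprSr.
Qed.

Lemma expmx_scale_continuous p (A : 'M[R]_p) s e : 0 < e ->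
  exists2 q, 0 < q & forall t, `|t - s| < q ->
    opn (expmx (t *: A) - expmx (s *: A)) < e.
Proof.
move=> e0; set K := expR (opn (s *: A)) * (opn A * expR (opn A)).
have K0 : 0 <= K by rewrite !mulr_ge0 ?expR_ge0 ?opn_ge0.
exists (Num.min 1 (e / (K + 1))).
  by rewrite lt_min ltr01 divr_gt0 // ltr_wpDl.
move=> t; rewrite lt_min => /andP[t1 tK].
have -> : expmx (t *: A) - expmx (s *: A)
    = expmx (s *: A) * (expmx ((t - s) *: A) - 1).
  by rewrite mulrBr mulr1 -expmx_scaleD subrKC.
have hts : opn ((t - s) *: A) <= `|t - s| * opn A by exact: opnZ.
apply: (@le_lt_trans _ _ (K * `|t - s|)).
  apply: le_trans (opnM _ _) _; rewrite /K -mulrA.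
  apply: ler_pM; rewrite ?opn_ge0 ?opn_expmx //.
  apply: le_trans (opn_expmx_sub1 _) _.
  rewrite [leRHS](_ : _ = `|t - s| * opn A * expR (opn A)); last by ring.
  apply: ler_pM; rewrite ?opn_ge0 ?expR_ge0 // ler_expR (le_trans hts) //.
  by rewrite ler_piMl ?opn_ge0 // ltW.
move: tK; rewrite ltr_pdivlMr ?ltr_wpDl //; apply: le_lt_trans.
by rewrite mulrC ler_wpM2l // lerDl.
Qed.

End Exponential.

(** * One-parameter subgroups of closed graded groups *)

Section GradedGroup.
Variable R : realType.

(** [F] encodes the subgroup [{(s, A) | F s A}] of the product of the additive
    group of reals and the general linear group; the last field says that it is
    closed, in a form that does not mention sequences. *)
Record closed_graded_group p (F : R -> set 'M[R]_p) : Prop := ClosedGradedGroup {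
  graded1 : F 0 1;
  gradedM : forall s t A B, F s A -> F t B -> F (s + t) (A * B);
  gradedV : forall s A, F s A -> A \in unitmx /\ F (- s) (invmx A);
  graded_closed : forall s A,
    (forall e, 0 < e ->
       exists t B, [/\ F t B, `|t - s| < e & opn (B - A) < e]) -> F s A }.

(** [M] is the velocity at the unit of arcs of [F] running at unit speed in the
    real coordinate. *)
Definition unit_speed_tangent p (F : R -> set 'M[R]_p) (M : 'M[R]_p) : Prop :=
  forall e, 0 < e -> exists s B,
    [/\ F s B, s != 0, `|s| < e & opn (B - 1 - s *: M) <= e * `|s|].

Lemma gradedX p (F : R -> set 'M[R]_p) s A n : closed_graded_group F ->
  F s A -> F (n%:R * s) (A ^+ n).
Proof.
move=> gF FA; elim: n => [|n ih].
  by rewrite mul0r expr0; exact: graded1.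
by rewrite -natr1 mulrDl mul1r exprSr; exact: gradedM.
Qed.

Lemma graded_opp p (F : R -> set 'M[R]_p) : closed_graded_group F ->
  closed_graded_group (fun s => F (- s)).
Proof.
move=> gF; split.
- by rewrite oppr0; exact: graded1.
- by move=> s t A B FA FB; rewrite opprD; exact: gradedM.
- by move=> s A FA; exact: gradedV.
- move=> s A h; apply: graded_closed => // e e0.
  have [t [B [FB ts BA]]] := h e e0.
  by exists (- t), B; split=> //; rewrite -opprD normrN.
Qed.

(** About [s / x] factors, each with an error [x * d * K], lead to a total error
    proportional to [d]. *)
Lemma powers_exp_bound (x d c K s : R) (n : nat) : 0 <= x -> 0 <= d ->
  0 <= c -> 0 <= K -> n%:R * x <= s ->
  n%:R * expR (x * c) ^+ n.-1 * (x * d * K) <= expR (s * c) * (s * K) * d.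
Proof.
move=> x0 d0 c0 K0 nxs.
apply: (@le_trans _ _ (expR (s * c) * (n%:R * x * K) * d)); last first.
  rewrite ler_wpM2r // ler_wpM2l ?expR_ge0 // ler_wpM2r //.
rewrite [leLHS](_ : _ = expR (x * c) ^+ n.-1 * (n%:R * x * K) * d); last by ring.
rewrite ler_wpM2r // ler_wpM2r ?mulr_ge0 //.
rewrite -expRM_natl ler_expR (le_trans _ (ler_wpM2r c0 nxs)) //.
by rewrite mulrA ler_wpM2r // ler_wpM2r // ler_nat leq_pred.
Qed.

(** If [B] in [F x] is close to [1 + x M], its power of exponent the integer part
    of [s / x] lies over a real number close to [s] and, by [opn_expB], is close to
    [exp (s M)]. *)
Lemma graded_exp_pos p (F : R -> set 'M[R]_p) (M : 'M[R]_p) :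
  closed_graded_group F ->
  (forall e, 0 < e -> exists s B,
    [/\ F s B, 0 < s, s < e & opn (B - 1 - s *: M) <= e * s]) ->
  forall s, 0 <= s -> F s (expmx (s *: M)).
Proof.
move=> gF hM s s0; apply: graded_closed => // e e0.
set c := opn M; have c0 : 0 <= c := opn_ge0 M.
(* [K] is the error of one factor relative to [x * d]; the first term of [L] adds
   up the errors of the factors, the second accounts for rounding [s / x]. *)
set K := 1 + c ^+ 2 * expR c.
set L := expR (s * (c + 1)) * (s * K) + expR (s * (c + 1)) * (c * expR c).
have K0 : 0 <= K by rewrite addr_ge0 // mulr_ge0 ?exprn_ge0 ?expR_ge0.
have L0 : 0 <= L by rewrite addr_ge0 // !mulr_ge0 ?expR_ge0.
set d := Num.min 1 (e / (L + 1)).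
have d0 : 0 < d by rewrite lt_min ltr01 divr_gt0 // ltr_wpDl.
have d1 : d <= 1 by rewrite ge_min lexx.
have dL : L * d < e.
  have : d <= e / (L + 1) by rewrite ge_min lexx orbT.
  rewrite ler_pdivlMr ?ltr_wpDl // mulrC mulrDl mul1r => /lt_le_trans; apply.
  by rewrite ltrDl.
have de : d <= e.
  have : d <= e / (L + 1) by rewrite ge_min lexx orbT.
  move=> /le_trans; apply; rewrite ler_pdivrMr ?ltr_wpDl //.
  by rewrite ler_pMr // lerDr.
have [x [B [FB x0 xd BM]]] := hM d d0.
have x1 : x <= 1 by rewrite (le_trans (ltW xd)).
set n := Num.truncn (s / x).
have [ns sn] : n%:R * x <= s /\ s < n.+1%:R * x.
  have /andP[h1 h2] := @truncn_itv R (s / x) (divr_ge0 s0 (ltW x0)).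
  by rewrite -ler_pdivlMr // -ltr_pdivrMr.
have sd : 0 <= s - n%:R * x <= x.
  by rewrite subr_ge0 ns lerBlDl; rewrite -natr1 mulrDl mul1r in sn; rewrite ltW.
set C := expmx (x *: M).
have xM : opn (x *: M) <= x * c by rewrite (le_trans (opnZ _ _)) // ger0_norm ?(ltW x0).
have CM : opn (C - 1 - x *: M) <= x * d * (c ^+ 2 * expR c).
  apply: le_trans (opn_expmx_sub1D _) _.
  apply: (@le_trans _ _ ((x * c) ^+ 2 * expR c)).
    apply: ler_pM; rewrite ?exprn_ge0 ?opn_ge0 ?expR_ge0 //.
      by rewrite lerXn2r ?nnegrE ?opn_ge0 // mulr_ge0 // ltW.
    by rewrite ler_expR (le_trans xM) // ler_piMl // ltW.
  rewrite exprMn -[leLHS]mulrA.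
  rewrite ler_wpM2r ?mulr_ge0 ?exprn_ge0 ?expR_ge0 //.
  by rewrite expr2 ler_wpM2l ?ltW.
have BC : opn (B - C) <= x * d * K.
  have -> : B - C = (B - 1 - x *: M) - (C - 1 - x *: M).
    by rewrite [- (C - 1 - _)]opprB subrKA opprB subrKA.
  apply: le_trans (opnB _ _) _.
  by rewrite /K mulrDr mulr1 [x * d]mulrC in CM *; apply: lerD.
set r := expR (x * (c + 1)).
have Br : opn B <= r.
  have -> : B = (B - 1 - x *: M) + (1 + x *: M).
    by rewrite [1 + _]addrC addrA !subrK.
  apply: le_trans (opnD _ _) _; apply: le_trans (expR_ge1Dx _).
  have := opnD 1 (x *: M); have := opn1 R p.
  have : d * x <= x by rewrite ler_piMl // ltW.
  lra.
have Cr : opn C <= r.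
  apply: le_trans (opn_expmx _) _; rewrite ler_expR (le_trans xM) //.
  by rewrite ler_wpM2l ?lerDl // ltW.
exists (n%:R * x), (B ^+ n); split.
- exact: gradedX.
- case/andP: sd => sd0 sdx; rewrite distrC ger0_norm //.
  by rewrite (le_lt_trans sdx) // (lt_le_trans xd).
rewrite (le_lt_trans _ dL) //.
have -> : B ^+ n - expmx (s *: M) = (B ^+ n - C ^+ n) - (expmx (s *: M) - C ^+ n).
  by rewrite opprB addrA subrK.
apply: le_trans (opnB _ _) _; rewrite /L mulrDl; apply: lerD.
  apply: le_trans (opn_expB n Br Cr) _.
  apply: le_trans (ler_wpM2l _ BC) _; first by rewrite mulr_ge0 // exprn_ge0 ?expR_ge0.
  by apply: powers_exp_bound => //; [exact: ltW|exact: ltW|exact: addr_ge0].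
have -> : expmx (s *: M) - C ^+ n =
   C ^+ n * (expmx ((s - n%:R * x) *: M) - 1).
  by rewrite mulrBr mulr1 -expmx_scaleX -expmx_scaleD subrKC.
case/andP: sd => sd0 sdx.
apply: le_trans (opnM _ _) _; rewrite -mulrA; apply: ler_pM; rewrite ?opn_ge0 //.
  rewrite -expmx_scaleX; apply: le_trans (opn_expmx _) _; rewrite ler_expR.
  apply: le_trans (opnZ _ _) _; rewrite ger0_norm ?mulr_ge0 ?(ltW x0) //.
  by apply: ler_pM => //; rewrite ?mulr_ge0 ?(ltW x0) ?lerDl.
have hs : opn ((s - n%:R * x) *: M) <= d * c.
  apply: le_trans (opnZ _ _) _; rewrite ger0_norm // ler_wpM2r //.
  by rewrite (le_trans sdx) // ltW.
apply: le_trans (opn_expmx_sub1 _) _.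
rewrite [leRHS](_ : _ = d * c * expR c); last by ring.
apply: ler_pM; rewrite ?expR_ge0 ?opn_ge0 //.
by rewrite ler_expR (le_trans hs) // ler_piMl.
Qed.

(** One of the two signs occurs for arbitrarily small real coordinates; a negative
    sign is reduced to [graded_exp_pos] by reversing the grading. *)
Lemma graded_exp p (F : R -> set 'M[R]_p) (M : 'M[R]_p) :
  closed_graded_group F -> unit_speed_tangent F M ->
  forall s, F s (expmx (s *: M)).
Proof.
move=> gF hM.
have inv_exp t : F t (expmx (t *: M)) -> F (- t) (expmx (- t *: M)).
  move=> /(gradedV gF)[u]; suff -> : invmx (expmx (t *: M)) = expmx (- t *: M) by [].
  by rewrite -[LHS]mulmx1 -[X in _ *m X](expmx_scaleKN M t) mulKmx.
have [hp|hn] := pselect (forall e, 0 < e -> exists s B,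
    [/\ F s B, 0 < s, s < e & opn (B - 1 - s *: M) <= e * s]).
  move=> s; have [s0|/ltW s0] := leP 0 s; first exact: graded_exp_pos.
  rewrite -[s]opprK; apply: inv_exp; apply: graded_exp_pos => //.
  by rewrite oppr_ge0.
have hn' : forall e, 0 < e -> exists s B,
    [/\ F (- s) B, 0 < s, s < e & opn (B - 1 - s *: (- M)) <= e * s].
  move/existsNP : hn => [e1 /not_implyP[e10 hn]] e e0.
  have m0 : 0 < Num.min e e1 by rewrite lt_min e0.
  have [s [B [FB s0 se BM]]] := hM _ m0.
  have sneg : s < 0.
    rewrite lt_neqAle s0 /= leNgt; apply/negP => sp; apply: hn; exists s, B.
    rewrite gtr0_norm // in se BM; split=> //.
      by move: se; rewrite lt_min => /andP[].
    by apply: le_trans BM _; rewrite ler_wpM2r ?(ltW sp) // ge_min lexx orbT.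
  exists (- s), B; rewrite ltr0_norm // in se BM; rewrite opprK oppr_gt0; split=> //.
    by move: se; rewrite lt_min => /andP[].
  rewrite scalerN scaleNr opprK.
  by apply: le_trans BM _; rewrite ler_wpM2r ?oppr_ge0 ?(ltW sneg) // ge_min lexx.
have key := graded_exp_pos (graded_opp gF) hn'.
move=> s; have [s0|/ltW s0] := leP 0 s; last first.
  by have := key (- s); rewrite opprK scalerN scaleNr opprK; apply; rewrite oppr_ge0.
have := key s s0; rewrite scalerN -scaleNr => /inv_exp.
by rewrite opprK.
Qed.

End GradedGroup.

(** * Fixed points of bounded linear groups on convex sets *)

Section FixedPoint.
Variables (R : realType) (m n : nat).
Local Notation M := 'M[R]_(m, n).
Implicit Types x y z : M.

Definition frob x : R := \sum_i \sum_j x i j ^+ 2.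

Lemma frob_ge0 x : 0 <= frob x.
Proof. by apply: sumr_ge0 => i _; apply: sumr_ge0 => j _; exact: sqr_ge0. Qed.

Lemma frob_parallelogram x y :
  frob (2^-1 *: (x + y)) = 2^-1 * (frob x + frob y) - 4^-1 * frob (x - y).
Proof.
rewrite /frob -big_split !mulr_sumr -sumrB; apply: eq_bigr => i _.
rewrite -big_split !mulr_sumr -sumrB; apply: eq_bigr => j _ /=.
by rewrite !mxE; field.
Qed.

(** Large enough to compare [frob] with the square of [opn] in both directions. *)
Definition frob_const : R := n%:R + m%:R * n%:R + 1.

Lemma frob_const_gt0 : 0 < frob_const.
Proof. by rewrite ltr_wpDl // addr_ge0 // mulr_ge0. Qed.

Lemma opn_le_frob x : opn x <= frob_const * Num.sqrt (frob x).
Proof.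
apply: le_trans (opn_le_norm _) _; apply: ler_pM => //.
  by rewrite /frob_const -addrA lerDl addr_ge0 // mulr_ge0.
apply: norm_le => [|i j]; first exact: sqrtr_ge0.
rewrite -sqrtr_sqr ler_wsqrtr // /frob (bigD1 i) //= (bigD1 j) //= -addrA lerDl.
apply: addr_ge0; apply: sumr_ge0 => k _; first exact: sqr_ge0.
by apply: sumr_ge0 => l _; exact: sqr_ge0.
Qed.

Lemma frob_le_opn x : frob x <= (frob_const * opn x) ^+ 2.
Proof.
apply: (@le_trans _ _ (m%:R * n%:R * opn x ^+ 2)).
  apply: (@le_trans _ _ (\sum_(i < m) \sum_(j < n) opn x ^+ 2)).
    apply: ler_sum => i _; apply: ler_sum => j _.
    rewrite -real_normK ?num_real // lerXn2r ?nnegrE ?opn_ge0 //.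
    exact: entry_le_opn.
  by rewrite !sumr_const !card_ord -mulrnA -[leLHS]mulr_natl mulnC natrM.
rewrite exprMn ler_wpM2r ?exprn_ge0 ?opn_ge0 //.
have mn0 : 0 <= m%:R * n%:R :> R by rewrite mulr_ge0.
have h : m%:R * n%:R + 1 <= frob_const.
  by rewrite /frob_const -addrA lerDr.
have h1 : 1 <= frob_const by rewrite (le_trans _ h) // lerDr.
apply: (@le_trans _ _ frob_const); first by rewrite (le_trans _ h) // lerDl.
by rewrite expr2 ler_peMr // ltW // frob_const_gt0.
Qed.

Variables (Phi : set (M -> M)) (S : set M) (C : R).
Hypothesis Phi_id : Phi id.
Hypothesis PhiM : forall f g, Phi f -> Phi g -> Phi (f \o g).
Hypothesis PhiV : forall f, Phi f -> exists2 g, Phi g & cancel f g.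
Hypothesis Phi_linear : forall f, Phi f -> linear f.
Hypothesis Phi_bounded : forall f, Phi f -> forall x, opn (f x) <= C * opn x.
Hypothesis S_inhabited : S !=set0.
Hypothesis S_invariant : forall f x, Phi f -> S x -> S (f x).
Hypothesis S_midpoint : forall x y, S x -> S y -> S (2^-1 *: (x + y)).
Hypothesis S_closed : forall (u : nat -> M) x,
  (forall k, S (u k)) -> u @ \oo --> x -> S x.

(** The square root of this function is a norm that the group preserves. *)
Let orbit_sup x := sup [set frob (f x) | f in Phi].

Let c : R := (frob_const * Num.max C 1 * frob_const) ^+ 2.

Let c_gt0 : 0 < c.
Proof.
by rewrite exprn_gt0 // !mulr_gt0 ?frob_const_gt0 // lt_max ltr01 orbT.
Qed.

Let frob_Phi f x : Phi f -> frob (f x) <= c * frob x.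
Proof.
move=> Pf; apply: le_trans (frob_le_opn _) _.
have k0 := ltW frob_const_gt0.
have C1 : 0 <= Num.max C 1 by rewrite le_max ler01 orbT.
apply: (@le_trans _ _ ((frob_const * (Num.max C 1
   * (frob_const * Num.sqrt (frob x)))) ^+ 2)); last first.
  by rewrite 2!mulrA exprMn sqr_sqrtr ?frob_ge0.
rewrite lerXn2r ?nnegrE ?mulr_ge0 ?opn_ge0 ?sqrtr_ge0 //.
rewrite ler_wpM2l // (le_trans (Phi_bounded Pf x)) //.
apply: (@le_trans _ _ (Num.max C 1 * opn x)).
  by rewrite ler_wpM2r ?opn_ge0 // le_max lexx.
by rewrite ler_wpM2l // opn_le_frob.
Qed.

Let frob_le_orbit_sup f x : Phi f -> frob (f x) <= orbit_sup x.
Proof.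
move=> Pf; apply: ub_le_sup; last by exists f.
by exists (c * frob x) => _ [g Pg <-]; exact: frob_Phi.
Qed.

Let orbit_sup_le b x : (forall f, Phi f -> frob (f x) <= b) -> orbit_sup x <= b.
Proof.
move=> h; apply: ge_sup; first by exists (frob (id x)), id.
by move=> _ [g Pg <-]; exact: h.
Qed.

Let orbit_sup_ge0 x : 0 <= orbit_sup x.
Proof. exact: le_trans (frob_ge0 _) (frob_le_orbit_sup x Phi_id). Qed.

Let orbit_sup_Phi f x : Phi f -> orbit_sup (f x) <= orbit_sup x.
Proof.
move=> Pf; apply: orbit_sup_le => g Pg.
exact: (@frob_le_orbit_sup (g \o f) x (PhiM Pg Pf)).
Qed.

Let infimum := inf [set orbit_sup x | x in S].

Let infimum_le x : S x -> infimum <= orbit_sup x.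
Proof.
move=> Sx; apply: ge_inf; last by exists x.
by exists 0 => _ [y _ <-]; exact: orbit_sup_ge0.
Qed.

(** Uniform convexity: by the parallelogram identity, passing to the midpoint
    gains a fixed fraction of [frob (x - y)] at each point of the orbit, because the
    inverses of the maps in [Phi] are bounded as well. *)
Let near_minimisers x y : S x -> S y ->
  frob (x - y) <= 2 * c * ((orbit_sup x - infimum) + (orbit_sup y - infimum)).
Proof.
move=> Sx Sy.
suff h : infimum <= 2^-1 * (orbit_sup x + orbit_sup y) - 4^-1 * (frob (x - y) / c).
  have e : frob (x - y) = c * (frob (x - y) / c) by rewrite mulrC divfK ?gt_eqF.
  rewrite {1}e [leRHS](_ : _ = c * (2 * (orbit_sup x - infimum
     + (orbit_sup y - infimum)))); last by ring.
  apply: ler_wpM2l; first exact: ltW.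
  move: h; set q := _ / c; lra.
apply: le_trans (infimum_le (S_midpoint Sx Sy)) _.
apply: orbit_sup_le => f Pf; have lf := Phi_linear Pf.
have f0 : f 0 = 0.
  have := lf 1 0 0; rewrite !scale1r !addr0 => /eqP.
  by rewrite -subr_eq0 opprD addrA subrr sub0r oppr_eq0 => /eqP.
have fZ a z : f (a *: z) = a *: f z by rewrite -[a *: z]addr0 lf f0 addr0.
have fD z w : f (z + w) = f z + f w by rewrite -[z]scale1r lf !scale1r.
have fB z w : f (z - w) = f z - f w by rewrite fD -scaleN1r fZ scaleN1r.
rewrite fZ fD frob_parallelogram -fB; apply: lerB.
  by rewrite ler_wpM2l // lerD ?frob_le_orbit_sup.
rewrite ler_wpM2l // ler_pdivrMr // mulrC.
have [g Pg gK] := PhiV Pf.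
by rewrite -{1}[x - y]gK; exact: frob_Phi.
Qed.

(** A minimising sequence of [orbit_sup] on [S] is Cauchy by [near_minimisers].
    A map of [Phi] sends it to another minimising sequence, which has to come close
    to it, so that the limit is fixed. *)
Lemma fixed_point_exists : exists2 x, S x & forall f, Phi f -> f x = x.
Proof.
have k0 := frob_const_gt0.
have nearmin k : exists2 x, S x & orbit_sup x < infimum + k.+1%:R^-1.
  have [_ [x Sx <-] xlt] : exists2 q, [set orbit_sup x | x in S] q &
      q < infimum + k.+1%:R^-1.
    apply: inf_adherent; first by rewrite invr_gt0.
    split; first by case: S_inhabited => x Sx; exists (orbit_sup x), x.
    by exists 0 => _ [y _ <-]; exact: orbit_sup_ge0.
  by exists x.
pose u k := s2val (cid2 (nearmin k)).
have Su k : S (u k) by rewrite /u; case: cid2.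
have uq k : orbit_sup (u k) < infimum + k.+1%:R^-1 by rewrite /u; case: cid2.
have close e : 0 < e -> exists N, forall k x y, (N <= k)%N -> S x -> S y ->
    orbit_sup x < infimum + k.+1%:R^-1 -> orbit_sup y < infimum + k.+1%:R^-1 ->
    opn (x - y) < e.
  move=> e0; have c4 : 0 < 4 * c by exact: mulr_gt0 (ltr0n _ 4) c_gt0.
  have d0 : 0 < (e / frob_const) ^+ 2 / (4 * c).
    by apply: divr_gt0 => //; exact/exprn_gt0/divr_gt0.
  exists (Num.truncn ((e / frob_const) ^+ 2 / (4 * c))^-1) => k x y Nk Sx Sy xq yq.
  have hk : k.+1%:R^-1 < (e / frob_const) ^+ 2 / (4 * c).
    rewrite invf_plt ?posrE ?ltr0Sn //; apply: lt_le_trans (truncnS_gt _) _.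
    by rewrite ler_nat ltnS.
  rewrite (le_lt_trans (opn_le_frob _)) // mulrC -ltr_pdivlMr //.
  rewrite -(@ltr_pXn2r _ 2) ?nnegrE ?sqrtr_ge0 ?divr_ge0 ?(ltW e0) ?(ltW k0) //.
  rewrite sqr_sqrtr ?frob_ge0 //; apply: le_lt_trans (near_minimisers Sx Sy) _.
  move: hk; rewrite ltr_pdivlMr //; apply: le_lt_trans.
  rewrite [leRHS](_ : _ = 2 * c * (k.+1%:R^-1 + k.+1%:R^-1)); last by ring.
  apply: ler_wpM2l; first exact: mulr_ge0 (ler0n _ 2) (ltW c_gt0).
  by apply: lerD; rewrite lerBlDl ltW.
have inv_le : forall a b : nat, (a <= b)%N -> b.+1%:R^-1 <= a.+1%:R^-1 :> R.
  by move=> a b ab; rewrite lef_pV2 ?posrE ?ltr0Sn // ler_nat ltnS.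
have [x ux] : exists x : M, u @ \oo --> x.
  apply: opn_cauchy_cvg => e e0; have [N hN] := close e e0; exists N => k l Nk Nl.
  have h i : (N <= i)%N -> orbit_sup (u i) < infimum + N.+1%:R^-1.
    by move=> Ni; rewrite (lt_le_trans (uq i)) // lerD2l inv_le.
  by apply: (hN N) => //; apply: h.
exists x; first exact: S_closed ux.
move=> f Pf; have lf := Phi_linear Pf.
have fB z w : f (z - w) = f z - f w.
  by rewrite -[z - w]addrC -scaleN1r lf scaleN1r addrC.
apply/eqP; rewrite -subr_eq0; apply/eqP/matrixP => i j; rewrite [RHS]mxE.
apply/eqP; rewrite -normr_le0; apply: le_trans (entry_le_opn _ i j) _.
apply/ler_addgt0Pr => e e0; rewrite add0r.
have C1 : 0 < Num.max C 1 by rewrite lt_max ltr01 orbT.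
have e1 : 0 < e / (3 * Num.max C 1) by rewrite divr_gt0 ?mulr_gt0.
have e3 : 0 < e / 3 by rewrite divr_gt0.
have [N hN] := close _ e3.
have /cvg_opnP/(_ _ e1) [N' _ hN'] := ux.
pose k := maxn N N'.
have h1 : opn (u k - x) < e / (3 * Num.max C 1) by apply: hN'; exact: leq_maxr.
have h2 : opn (f (u k) - u k) < e / 3.
  apply: (hN k) => //; [exact: leq_maxl | exact: S_invariant |].
  exact: le_lt_trans (orbit_sup_Phi _ Pf) _.
have h3 : opn (f x - f (u k)) <= e / 3.
  rewrite -fB (le_trans (Phi_bounded Pf _)) //.
  apply: (@le_trans _ _ (Num.max C 1 * opn (x - u k))).
    by rewrite ler_wpM2r ?opn_ge0 // le_max lexx.
  rewrite opnC mulrC -ler_pdivlMr //.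
  by rewrite -mulrA -invfM ltW.
have h4 : opn (u k - x) <= e / 3.
  rewrite (le_trans (ltW h1)) // ler_wpM2l ?(ltW e0) // lef_pV2 ?posrE ?mulr_gt0 //.
  by rewrite ler_peMr // le_max lexx orbT.
have -> : f x - x = (f x - f (u k)) + ((f (u k) - u k) + (u k - x)).
  by rewrite !addrA !subrK.
have := opnD (f x - f (u k)) ((f (u k) - u k) + (u k - x)).
have := opnD (f (u k) - u k) (u k - x).
lra.
Qed.

End FixedPoint.

(** * Decay of the exponential of a matrix with spectrum in a half plane *)

Section ComplexMatrices.
Variable R : realType.
Local Notation C := R[i].
Local Notation normc := (@Normc.normc R).

Lemma normc_ge0 (z : C) : 0 <= normc z.
Proof. by case: z => a b; exact: sqrtr_ge0. Qed.

Lemma normc_gt0 (z : C) : z != 0 -> 0 < normc z.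
Proof.
move=> z0; rewrite lt_neqAle normc_ge0 andbT eq_sym.
by apply: contra z0 => /eqP/Normc.eq0_normc ->.
Qed.

Lemma normc_real (x : R) : normc (real_complex R x) = `|x|.
Proof. by rewrite /Normc.normc /= expr0n /= addr0 sqrtr_sqr. Qed.

Lemma normc_sum_le (I : Type) (r : seq I) (F : I -> C) :
  normc (\sum_(i <- r) F i) <= \sum_(i <- r) normc (F i).
Proof.
elim/big_ind2 : _ => [|x a y b xa yb|//]; first by rewrite Normc.normc0.
exact: le_trans (le_normcD _ _) (lerD xa yb).
Qed.

Lemma complexmxM m n p (A : 'M[R]_(m, n)) (B : 'M[R]_(n, p)) :
  map_mx (real_complex R) (A *m B)
  = map_mx (real_complex R) A *m map_mx (real_complex R) B.
Proof. exact: map_mxM. Qed.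

Lemma complexmxX p (A : 'M[R]_p) k : complexmx (A ^+ k) = complexmx A ^+ k.
Proof.
elim: k => [|k ih]; first by rewrite !expr0 /complexmx map_mx1.
by rewrite !exprS -[RHS]/(_ *m _) -ih /complexmx -complexmxM.
Qed.

Lemma complexmx_inj p : injective (@complexmx R p).
Proof.
move=> A B /matrixP AB; apply/matrixP => i j.
by have := AB i j; rewrite !mxE => -[].
Qed.

(** The Cayley-Hamilton theorem for a split characteristic polynomial, stated with
    matrices so as to make sense in dimension 0. *)
Lemma eigenvalue_annihilator p (A : 'M[C]_p) : exists rs : seq C,
  (forall z, (z \in rs) = eigenvalue A z) /\ \prod_(z <- rs) (A - z%:M) = 0.
Proof.
case: p A => [|p] A.
  exists [::]; split=> [z|]; last by apply/matrixP => -[].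
  rewrite in_nil; apply/esym/negbTE/negP => /eigenvalueP[v _ v0].
  by case/eqP: v0; apply/rowP => -[].
have [rs hrs] := closed_field_poly_normal (char_poly A); exists rs.
have mon : lead_coef (char_poly A) = 1.
  by apply/eqP; have := char_poly_monic A; rewrite monicE.
rewrite mon scale1r in hrs; split.
  by move=> z; rewrite eigenvalue_root_char hrs root_prod_XsubC.
have := Cayley_Hamilton A; rewrite hrs rmorph_prod /= => h.
rewrite -[RHS]h; apply: eq_bigr => z _.
by rewrite rmorphB /= horner_mx_X horner_mx_C.
Qed.

(** A matrix commuting with [A] stabilises each eigenspace of [A], hence has an
    eigenvector in it. *)
Lemma eigenvalue_common_eigenvector p (A B : 'M[C]_p) z :
  A *m B = B *m A -> eigenvalue A z ->
  exists (v : 'rV[C]_p) (w : C), [/\ v != 0, v *m A = z *: v & v *m B = w *: v].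
Proof.
move=> AB Az; set V := row_base (eigenspace A z).
have V0 : (0 < \rank (eigenspace A z))%N by rewrite lt0n mxrank_eq0.
have VB : (V *m B <= V)%MS.
  have VW : (V <= eigenspace A z)%MS by rewrite eq_row_base.
  apply: submx_trans (submxMr B VW) _; rewrite eq_row_base.
  exact: comm_mx_stable_eigenspace.
have [w /eigenvalueP[u uB u0]] := eigenvalue_closed (V *m B *m pinvmx V) V0.
exists (u *m V), w; split.
- by rewrite mulmx_free_eq0 ?row_base_free.
- apply/eigenspaceP; apply: submx_trans (submxMl _ _) _.
  by rewrite eq_row_base.
- by rewrite -mulmxA -(mulmxKpV VB) mulmxA uB scalemxAl.
Qed.

Definition normcmx m n (Y : 'M[C]_(m, n)) : R := \sum_i \sum_j normc (Y i j).

Lemma normcmx_ge0 m n (Y : 'M[C]_(m, n)) : 0 <= normcmx Y.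
Proof. by apply: sumr_ge0 => i _; apply: sumr_ge0 => j _; exact: normc_ge0. Qed.

Lemma normcmx_entry m n (Y : 'M[C]_(m, n)) i j : normc (Y i j) <= normcmx Y.
Proof.
rewrite /normcmx (bigD1 i) //= (bigD1 j) //= -addrA lerDl.
apply: addr_ge0; apply: sumr_ge0 => k _; first exact: normc_ge0.
by apply: sumr_ge0 => l _; exact: normc_ge0.
Qed.

Lemma normcmxD m n (Y Z : 'M[C]_(m, n)) : normcmx (Y + Z) <= normcmx Y + normcmx Z.
Proof.
rewrite /normcmx -big_split; apply: ler_sum => i _.
rewrite -big_split; apply: ler_sum => j _ /=.
by rewrite mxE le_normcD.
Qed.

Lemma normcmxZ m n z (Y : 'M[C]_(m, n)) : normcmx (z *: Y) = normc z * normcmx Y.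
Proof.
rewrite /normcmx mulr_sumr; apply: eq_bigr => i _.
by rewrite mulr_sumr; apply: eq_bigr => j _; rewrite mxE Normc.normcM.
Qed.

Lemma normcmx_mulr_real m n p (Y : 'M[C]_(m, n)) (A : 'M[R]_(n, p)) :
  normcmx (Y *m map_mx (real_complex R) A) <= normcmx Y * opn A.
Proof.
rewrite /normcmx mulr_suml; apply: ler_sum => i _.
apply: (@le_trans _ _ (\sum_j \sum_k normc (Y i k) * `|A k j|)).
  apply: ler_sum => j _; rewrite mxE; apply: le_trans (normc_sum_le _ _) _.
  by apply: ler_sum => k _; rewrite mxE Normc.normcM normc_real.
rewrite exchange_big mulr_suml; apply: ler_sum => k _ /=.
by rewrite -mulr_sumr ler_wpM2l ?normc_ge0 // row_sum_le_opn.
Qed.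

Lemma affine_recurrence_small (a b : nat -> R) (r : R) :
  0 <= r -> r < 1 -> (forall k, 0 <= a k) -> (forall k, a k.+1 <= r * a k + b k) ->
  (forall e, 0 < e -> exists N, forall k, (N <= k)%N -> b k < e) ->
  forall e, 0 < e -> exists N, forall k, (N <= k)%N -> a k < e.
Proof.
move=> r0 r1 a0 ab hb e e0.
have d0 : 0 < (1 - r) * (e / 2) by rewrite mulr_gt0 ?divr_gt0 ?subr_gt0.
have [N hN] := hb _ d0.
have step j : a (N + j)%N <= r ^+ j * a N + e / 2.
  elim: j => [|j ih].
    by rewrite addn0 expr0 mul1r lerDl divr_ge0 // ltW.
  rewrite addnS; apply: le_trans (ab _) _.
  have := hN (N + j)%N (leq_addr _ _); have := ler_wpM2l r0 ih.
  rewrite exprS; set x := r ^+ j; set y := a N; rewrite mulrDr mulrA; lra.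
have e1 : 0 < e / 2 / (a N + 1) by rewrite divr_gt0 ?divr_gt0 // ltr_wpDl.
have : r ^+ x @[x --> \oo] --> (0 : R) by apply: cvg_expr; rewrite ger0_norm.
move=> /cvgr0Pnorm_lt/(_ _ e1)[J _ hJ].
exists (N + J)%N => k Nk; have Nk' : (N <= k)%N by rewrite (leq_trans _ Nk) ?leq_addr.
rewrite -(subnKC Nk'); apply: le_lt_trans (step _) _.
have := hJ (k - N)%N; rewrite /= leq_subRL // => /(_ Nk).
rewrite ger0_norm ?exprn_ge0 // ltr_pdivlMr ?ltr_wpDl // => h.
have : r ^+ (k - N) * a N <= r ^+ (k - N) * (a N + 1).
  by rewrite ler_wpM2l ?exprn_ge0 // lerDl.
lra.
Qed.

(** One factor is removed at a time: [A ^+ k * Y] satisfies an affine recurrence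
    of ratio [z], whose forcing term [A ^+ k * ((A - z) * Y)] is small by induction. *)
Lemma powers_small_annihilated p (A : 'M[C]_p) (rs : seq C) (Y : 'M[C]_p) :
  (forall z, z \in rs -> normc z < 1) ->
  \prod_(z <- rs) (A - z%:M) * Y = 0 ->
  forall e, 0 < e -> exists N, forall k, (N <= k)%N -> normcmx (A ^+ k * Y) < e.
Proof.
elim/last_ind: rs Y => [|rs z ih] Y h.
  rewrite big_nil mul1r => -> e e0; exists 0%N => k _; rewrite mulr0.
  rewrite /normcmx big1 // => i _; rewrite big1 // => j _.
  by rewrite mxE Normc.normc0.
rewrite -cats1 big_cat big_seq1 /= -mulrA => hY.
apply: (@affine_recurrence_small _
  (fun k => normcmx (A ^+ k * ((A - z%:M) * Y))) (normc z)).
- exact: normc_ge0.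
- by apply: h; rewrite mem_rcons mem_head.
- by move=> k; exact: normcmx_ge0.
- move=> k; rewrite -normcmxZ; apply: le_trans (normcmxD _ _).
  suff -> : A ^+ k.+1 * Y = z *: (A ^+ k * Y) + A ^+ k * ((A - z%:M) * Y) by [].
  rewrite mulrBl mulrBr !mulrA -exprSr addrC.
  by rewrite -[_ * z%:M * _]/(_ *m z%:M *m _) mul_mx_scalar -scalemxAl subrK.
- apply: ih => // w wrs; apply: h.
  by rewrite mem_rcons inE wrs orbT.
Qed.

Lemma powers_small p (A : 'M[R]_p) :
  (forall z, eigenvalue (complexmx A) z -> normc z < 1) ->
  forall e, 0 < e -> exists N, forall k, (N <= k)%N -> opn (A ^+ k) < e.
Proof.
move=> h e e0; have [rs [hrs rs0]] := eigenvalue_annihilator (complexmx A).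
have e1 : 0 < e / (p%:R + 1) by rewrite divr_gt0 // ltr_wpDl.
have [||N hN] := @powers_small_annihilated _ (complexmx A) rs 1 _ _ _ e1.
- by move=> z; rewrite hrs; exact: h.
- by rewrite rs0 mul0r.
exists N => k /hN; rewrite mulr1 -complexmxX => hk.
apply: le_lt_trans (opn_le_norm _) _.
apply: (@le_lt_trans _ _ (p%:R * (e / (p%:R + 1)))).
  apply: ler_wpM2l => //; apply: norm_le => [|i j]; first exact: ltW.
  rewrite -normc_real; apply: le_trans (ltW hk).
  by have := normcmx_entry (complexmx (A ^+ k)) i j; rewrite mxE.
by rewrite mulrCA gtr_pMr // ltr_pdivrMr ?ltr_wpDl // mul1r ltrDl.
Qed.

(** The number [1 - t z] enters the unit disc at first order in [t], which leaves
    room for an error of order [t ^+ 2]. *)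
Lemma contracting_step (z : C) (K : R) : 0 < complex.Re z -> 0 <= K ->
  exists2 t0, 0 < t0 & forall t, 0 < t -> t <= t0 ->
    normc (1 - real_complex R t * z) + t ^+ 2 * K < 1.
Proof.
case: z => a b /= a0 K0.
set L := a ^+ 2 + b ^+ 2 + 2 * K + 1.
have ab0 : 0 <= a ^+ 2 + b ^+ 2 by rewrite addr_ge0 ?sqr_ge0.
have L1 : 1 <= L by rewrite /L; lra.
have L0 : 0 < L by rewrite (lt_le_trans ltr01).
exists (Num.min 1 (Num.min (a / L) (2 * L)^-1)).
  by rewrite !lt_min ltr01 divr_gt0 //= invr_gt0 mulr_gt0.
move=> t t0; rewrite !le_min => /and3P[t1 ta tL].
have tLa : t * L <= a by rewrite -ler_pdivlMr.
have tK : t ^+ 2 * K < 1.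
  have : t * (2 * L) <= 1 by rewrite -ler_pdivlMr ?mulr_gt0 // div1r.
  have : t * (2 * K) <= t * L by rewrite ler_wpM2l ?ltW // /L; lra.
  have : t * (t * K) <= 1 * (t * K) by rewrite ler_wpM2r ?mulr_ge0 // ltW.
  rewrite expr2 -mulrA; lra.
rewrite !mul0r subr0 addr0 sub0r.
rewrite -ltrBrDr -[ltRHS]ger0_norm ?subr_ge0 ?(ltW tK) //.
rewrite -sqrtr_sqr ltr_sqrt; last by rewrite exprn_gt0 // subr_gt0.
have : t * (t * L) <= t * a by rewrite ler_wpM2l // ltW.
have : 0 <= (t ^+ 2 * K) ^+ 2 by exact: sqr_ge0.
have : 0 < t * a by rewrite mulr_gt0.
rewrite /L !expr2 => *; nra.
Qed.

Lemma common_contracting_step (rs : seq C) (K : R) : 0 <= K ->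
  (forall z, z \in rs -> 0 < complex.Re z) ->
  exists2 t0, 0 < t0 & forall z t, z \in rs -> 0 < t -> t <= t0 ->
    normc (1 - real_complex R t * z) + t ^+ 2 * K < 1.
Proof.
move=> K0; elim: rs => [|z rs ih] h; first by exists 1.
have [|t1 t10 h1] := ih; first by move=> w wrs; apply: h; rewrite inE wrs orbT.
have [t2 t20 h2] := contracting_step (h z (mem_head _ _)) K0.
exists (Num.min t1 t2); first by rewrite lt_min t10.
move=> w t; rewrite inE le_min => wrs t0 /andP[tt1 tt2].
by case/orP: wrs => [/eqP ->|wrs]; [exact: h2 | exact: h1].
Qed.

(** For a small step [t], an eigenvalue [w] of [exp (- t H)] has a common
    eigenvector with [H], say for its eigenvalue [z], so that [w] differs from
    [1 - t z] by at most a multiple of [t ^ 2]. *)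
Lemma exp_contracting p (H : 'M[R]_p) :
  (forall x, real_spectrum H x -> 0 < x) ->
  exists2 t, 0 < t & forall w, eigenvalue (complexmx (expmx (- t *: H))) w ->
    normc w < 1.
Proof.
move=> hH; have [rs [hrs rs0]] := eigenvalue_annihilator (complexmx H).
set c := opn H; have c0 : 0 <= c := opn_ge0 H.
set K := c ^+ 2 * expR c.
have K0 : 0 <= K by rewrite mulr_ge0 ?expR_ge0 ?sqr_ge0.
have [t0 t00 ht] := common_contracting_step K0
  (fun z zrs => hH _ (ex_intro2 _ _ z (etrans (esym (hrs z)) zrs) erefl)).
set t := Num.min 1 t0.
have tpos : 0 < t by rewrite lt_min ltr01.
have [t1 tt0] : t <= 1 /\ t <= t0 by rewrite !ge_min !lexx orbT.
exists t => // w Aw; set A := expmx (- t *: H).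
have AH : complexmx A *m complexmx H = complexmx H *m complexmx A.
  rewrite /complexmx -!complexmxM; congr map_mx.
  apply: expmx_comm; rewrite /GRing.comm.
  by rewrite -[LHS]/(_ *m _) -[RHS]/(_ *m _) -scalemxAl -scalemxAr.
have [v [z [v0 vA vH]]] := eigenvalue_common_eigenvector AH Aw.
have zrs : z \in rs by rewrite hrs; apply/eigenvalueP; exists v.
set E := A - 1 - (- t *: H).
have EK : opn E <= t ^+ 2 * K.
  apply: le_trans (opn_expmx_sub1D _) _.
  have tc : opn (- t *: H) <= t * c.
    by apply: le_trans (opnZ _ _) _; rewrite normrN gtr0_norm.
  rewrite /K mulrA -exprMn; apply: ler_pM; rewrite ?expR_ge0 ?sqr_ge0 //.
    by rewrite lerXn2r ?nnegrE ?opn_ge0 // mulr_ge0 // ltW.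
  by rewrite ler_expR (le_trans tc) // ler_piMl.
have wv : w *: v = (1 - real_complex R t * z) *: v + v *m map_mx (real_complex R) E.
  rewrite /E !map_mxB map_mx1 map_mxZ mulmxBr mulmxBr mulmx1 -/(complexmx A) vA.
  rewrite -scalemxAr -/(complexmx H) vH scalerA scalerBl scale1r.
  by rewrite rmorphN mulNr scaleNr opprK [RHS]addrC -addrA subrKC subrK.
have nv0 : 0 < normcmx v.
  have [i vi0] : exists i, v 0 i != 0.
    apply/existsP; apply: contraT; rewrite negb_exists => /forallP h.
    case/eqP: v0; apply/rowP => i; rewrite mxE; apply/eqP.
    by have := h i; rewrite negbK.
  exact: lt_le_trans (normc_gt0 vi0) (normcmx_entry v 0 i).
have : normcmx (w *: v) <= (normc (1 - real_complex R t * z) + opn E) * normcmx v.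
  rewrite wv; apply: le_trans (normcmxD _ _) _; rewrite normcmxZ mulrDl lerD2l.
  by rewrite [leRHS]mulrC normcmx_mulr_real.
rewrite normcmxZ ler_pM2r // => /le_lt_trans; apply.
apply: le_lt_trans (ht z t zrs tpos tt0).
by rewrite lerD2l.
Qed.

(** For the step [t] of [exp_contracting] the powers of [exp (- t H)] tend to 0,
    and the factor left over from rounding [s / t] stays bounded. *)
Lemma expmx_decay p (H : 'M[R]_p) :
  (forall x, real_spectrum H x -> 0 < x) ->
  forall e, 0 < e -> exists s0, forall s, s0 <= s -> opn (expmx (- s *: H)) < e.
Proof.
move=> hH e e0; have [t t0 ht] := exp_contracting hH.
set b := expR (t * opn H); have b0 : 0 < b := expR_gt0 _.
have [N hN] := powers_small ht (divr_gt0 e0 b0).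
exists (N%:R * t) => s Ns.
have s0 : 0 <= s by rewrite (le_trans _ Ns) // mulr_ge0 // ltW.
set n := Num.truncn (s / t).
have /andP[h1 h2] := @truncn_itv R (s / t) (divr_ge0 s0 (ltW t0)).
rewrite -/n ler_pdivlMr // in h1; rewrite -/n ltr_pdivrMr // in h2.
have Nn : (N <= n)%N by rewrite truncn_ge_nat ?divr_ge0 ?(ltW t0) // ler_pdivlMr.
have -> : - s *: H = (n%:R * - t + (n%:R * t - s)) *: H.
  by congr (_ *: _); ring.
rewrite expmx_scaleD expmx_scaleX.
apply: le_lt_trans (opnM _ _) _.
have := hN n Nn; rewrite ltr_pdivlMr //; apply: le_lt_trans.
apply: ler_wpM2l; first exact: opn_ge0.
apply: le_trans (opn_expmx _) _; rewrite ler_expR.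
apply: le_trans (opnZ _ _) _; apply: ler_wpM2r; first exact: opn_ge0.
rewrite distrC ger0_norm ?subr_ge0 // lerBlDl.
by rewrite -natr1 mulrDl mul1r in h2; exact: ltW.
Qed.

End ComplexMatrices.

(** * The additive Jordan decomposition over the reals *)

Section Diagonalizable.
Variable F : fieldType.

Lemma diagonalizable_of_conj n (P A : 'M[F]_n) (d : 'rV[F]_n) : P \in unitmx ->
  P *m A = diag_mx d *m P -> diagonalizable A.
Proof.
move=> Pu PA; exists P => //; apply/similar_diagPex; exists d.
exact/(similarP Pu).
Qed.

Lemma simultaneous_diag n (A B : 'M[F]_n) : A *m B = B *m A ->
  diagonalizable A -> diagonalizable B ->
  exists (P : 'M[F]_n) (d e : 'rV[F]_n),
    [/\ P \in unitmx, P *m A = diag_mx d *m P & P *m B = diag_mx e *m P].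
Proof.
move=> AB dA dB.
have [|P Pu] := (codiagonalizableP [:: A; B]).1.
  split=> [f g|f]; rewrite !inE.
    by move=> /orP[]/eqP -> /orP[]/eqP ->; rewrite /comm_mx.
  by move=> /orP[]/eqP ->.
move=> /= /and3P[/similar_diagPex[d /(similarP Pu) hd]].
move=> /similar_diagPex[e /(similarP Pu) he] _.
by exists P, d, e.
Qed.

Lemma diagonalizableD n (A B : 'M[F]_n) : A *m B = B *m A ->
  diagonalizable A -> diagonalizable B -> diagonalizable (A + B).
Proof.
move=> AB dA dB; have [P [d [e [Pu hd he]]]] := simultaneous_diag AB dA dB.
apply: (@diagonalizable_of_conj _ P _ (d + e)) => //.
by rewrite mulmxDr hd he raddfD mulmxDl.
Qed.

Lemma diagonalizableB n (A B : 'M[F]_n) : A *m B = B *m A ->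
  diagonalizable A -> diagonalizable B -> diagonalizable (A - B).
Proof.
move=> AB dA dB; have [P [d [e [Pu hd he]]]] := simultaneous_diag AB dA dB.
apply: (@diagonalizable_of_conj _ P _ (d - e)) => //.
by rewrite mulmxBr hd he raddfB mulmxBl.
Qed.

(** In a diagonalising basis the powers are computed on the diagonal. *)
Lemma diagonalizable_nilpotent_eq0 n (A : 'M[F]_n) k :
  diagonalizable A -> A ^+ k = 0 -> A = 0.
Proof.
move=> [P Pu /similar_diagPex[d /(similarP Pu) hd]] Ak.
have hk j : P *m A ^+ j = diag_mx (\row_i d 0 i ^+ j) *m P.
  elim: j => [|j ih].
    rewrite expr0 mulmx1 (_ : \row_i _ = const_mx 1) ?diag_const_mx ?mul1mx //.
    by apply/rowP => i; rewrite !mxE expr0.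
  rewrite exprSr -[_ * _ as X in _ *m X]/(_ *m _) mulmxA ih -mulmxA hd mulmxA.
  congr (_ *m _); rewrite mulmx_diag; congr diag_mx.
  by apply/rowP => i; rewrite !mxE exprSr.
have dk : diag_mx (\row_i d 0 i ^+ k) = 0.
  have := hk k; rewrite Ak mulmx0 => /(congr1 (fun X => X *m invmx P)).
  by rewrite mul0mx mulmxK.
have d0 : d = 0.
  apply/rowP => i; rewrite [RHS]mxE; apply/eqP.
  have /matrixP/(_ i i) := dk; rewrite !mxE eqxx mulr1n => /eqP.
  by rewrite expf_eq0 => /andP[].
move: hd; rewrite d0 raddf0 mul0mx => /(congr1 (mulmx (invmx P))).
by rewrite mulmx0 mulKmx.
Qed.

Lemma nilpotent_sub (A : pzRingType) (x y : A) k l : GRing.comm x y ->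
  x ^+ k = 0 -> y ^+ l = 0 -> (x - y) ^+ (k + l) = 0.
Proof.
move=> xy xk yl; rewrite exprBn_comm //; apply: big1 => i _.
have [li|il] := leqP l i.
  have -> : y ^+ i = y ^+ (i - l) * y ^+ l by rewrite -exprD subnK.
  by rewrite yl !mulr0 mul0rn.
have -> : x ^+ (k + l - i) = x ^+ (l - i) * x ^+ k.
  by rewrite -exprD addnBAC ?(ltnW il) // [(l + k)%N]addnC.
by rewrite xk !mulr0 mul0r mul0rn.
Qed.

Lemma horner_mx_comp n (A : 'M[F]_n.+1) (p f : {poly F}) :
  horner_mx A (p \Po f) = horner_mx (horner_mx A f) p.
Proof.
elim/poly_ind: p => [|p c ih]; first by rewrite comp_poly0 !rmorph0.
rewrite comp_polyD comp_polyM comp_polyX comp_polyC !rmorphD !rmorphM /= ih.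
by rewrite horner_mx_X !horner_mx_C.
Qed.

Lemma horner_mx_prod_XsubC n (A : 'M[F]_n.+1) rs :
  horner_mx A (\prod_(z <- rs) ('X - z%:P)) = \prod_(z <- rs) (A - z%:M).
Proof.
rewrite rmorph_prod; apply: eq_bigr => z _.
by rewrite rmorphB /= horner_mx_X horner_mx_C.
Qed.

Lemma diagonalizable_of_annihilator n (A : 'M[F]_n) rs : uniq rs ->
  \prod_(z <- rs) (A - z%:M) = 0 -> diagonalizable A.
Proof.
case: n A => [|n] A urs h.
  have -> : A = 0 by apply/matrixP => -[].
  exact: diagonalizable0.
apply/diagonalizableP; exists rs => //; apply: mxminpoly_min.
by rewrite horner_mx_prod_XsubC.
Qed.

(** If no generalised eigenvector of height 2 exists, then repeated factors can
    be dropped from a split annihilating polynomial. *)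
Lemma diagonalizable_of_height1 n (A : 'M[F]_n) rs :
  \prod_(z <- rs) (A - z%:M) = 0 ->
  (forall z (Y : 'M[F]_n), Y * (A - z%:M) * (A - z%:M) = 0 -> Y * (A - z%:M) = 0) ->
  diagonalizable A.
Proof.
case: n A => [|n] A h ht.
  have -> : A = 0 by apply/matrixP => -[].
  exact: diagonalizable0.
apply: (@diagonalizable_of_annihilator _ _ (undup rs)); first exact: undup_uniq.
pose Q l : {poly F} := \prod_(z <- l) ('X - z%:P).
suff key l (f : {poly F}) : horner_mx A (f * Q l) = 0 ->
    horner_mx A (f * Q (undup l)) = 0.
  rewrite -horner_mx_prod_XsubC -[\prod_(_ <- _) _]mul1r; apply: key.
  by rewrite mul1r horner_mx_prod_XsubC.
elim: l f => [//|z l ih] f; rewrite /Q big_cons mulrA => /ih /=.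
case: ifPn => zl; last by rewrite /Q big_cons mulrA.
have zl' : z \in undup l by rewrite mem_undup.
rewrite /Q (perm_big _ (perm_to_rem zl')) big_cons /=.
set g := \prod_(_ <- _) _.
rewrite (_ : f * ('X - z%:P) * (('X - z%:P) * g)
  = (f * g) * ('X - z%:P) * ('X - z%:P)); last by ring.
rewrite (_ : f * (('X - z%:P) * g) = (f * g) * ('X - z%:P)); last by ring.
rewrite !(rmorphM (horner_mx A)) rmorphB /= horner_mx_X horner_mx_C.
exact: ht.
Qed.

Lemma comp_poly_taylor1 (p f h : {poly F}) : exists r,
  p \Po (f + h) = p \Po f + (p^`() \Po f) * h + h ^+ 2 * r.
Proof.
elim/poly_ind: p => [|p c [r hr]].
  by exists 0; rewrite deriv0 !comp_poly0; ring.
exists (r * (f + h) + (p^`() \Po f)).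
rewrite derivMXaddC !(comp_polyD, comp_polyM, comp_polyX, comp_polyC) hr.
ring.
Qed.

(** Newton iteration in the ring of polynomials modulo powers of [p], started at
    the approximate root ['X] of [p]. *)
Lemma separable_root_lift (p : {poly F}) j : coprimep p p^`() ->
  exists f : {poly F}, p %| 'X - f /\ p ^+ j.+1 %| p \Po f.
Proof.
move=> /Bezout_eq1_coprimepP[[v u] /= uv].
elim: j => [|j [f [pf pjf]]].
  by exists 'X; rewrite subrr dvdp0 comp_polyXr expr1 dvdpp.
pose h := - ((p \Po f) * (u \Po f)).
have [r hr] := comp_poly_taylor1 p f h; exists (f + h).
have ppf : p %| p \Po f by apply: dvdp_trans pjf; rewrite exprS dvdp_mulr.
split.
  by rewrite opprD addrA /h opprK dvdp_add // dvdp_mulr.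
have e : (v \Po f) * (p \Po f) + (u \Po f) * (p^`() \Po f) = 1.
  by rewrite -!comp_polyM -comp_polyD uv comp_polyC.
have -> : p \Po (f + h) =
    (p \Po f) * (p \Po f) * ((v \Po f) + (u \Po f) ^+ 2 * r).
  rewrite hr -{1}[p \Po f]mulr1 -e /h; ring.
by rewrite dvdp_mulr // exprS dvdp_mul.
Qed.

End Diagonalizable.

Section Jordan.
Variable R : realType.
Local Notation C := R[i].
Local Notation toC := (real_complex R).

Lemma real_poly_of_conj_invariant (q : {poly C}) :
  map_poly (@conjc R) q = q -> exists p : {poly R}, q = map_poly toC p.
Proof.
move=> hq; exists (map_poly (@complex.Re R) q); apply/polyP => i.
rewrite coef_map /= coef_map_id0 //=.
have : (q`_i)^*%C = q`_i by rewrite -[in RHS]hq coef_map.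
by case: (q`_i) => a b [] /eqP; rewrite eqNr => /eqP ->.
Qed.

Lemma conj_roots_real_poly (p : {poly R}) (z : C) :
  root (map_poly toC p) z -> root (map_poly toC p) z^*%C.
Proof.
move=> pz; have e : map_poly toC p = map_poly (@conjc R) (map_poly toC p).
  by apply/polyP => i; rewrite !coef_map /= oppr0.
by rewrite -complex_root_conj -e.
Qed.

(** The product of the distinct linear factors of the characteristic polynomial
    has real coefficients, because the roots come in conjugate pairs. *)
Lemma separable_annihilator n (E : 'M[R]_n.+1) : exists (p : {poly R}) k rs,
  [/\ coprimep p p^`(), horner_mx E (p ^+ k) = 0, uniq rs &
      map_poly toC p = \prod_(z <- rs) ('X - z%:P)].
Proof.
have [rs [hrs rs0]] := eigenvalue_annihilator (complexmx E).
set us := undup rs; have uus : uniq us by exact: undup_uniq.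
have conj_us z : z \in us -> z^*%C \in us.
  rewrite !mem_undup !hrs !eigenvalue_root_char /complexmx -map_char_poly.
  exact: conj_roots_real_poly.
have [p hp] : exists p : {poly R}, \prod_(z <- us) ('X - z%:P) = map_poly toC p.
  apply: real_poly_of_conj_invariant; rewrite rmorph_prod /=.
  transitivity (\prod_(z <- [seq z^*%C | z <- us]) ('X - z%:P) : {poly C}).
    by rewrite big_map; apply: eq_bigr => z _; rewrite map_polyXsubC.
  apply: perm_big; apply: uniq_perm => //.
    by rewrite map_inj_uniq //; exact: can_inj (@conjcK R).
  move=> z; apply/mapP/idP => [[w wus ->]|zus]; first exact: conj_us.
  by exists z^*%C; [exact: conj_us | rewrite conjcK].
exists p, (size rs), us; split=> //.
  rewrite -(coprimep_map toC) -deriv_map -hp.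
  by have := separable_prod_XsubC us; rewrite uus separable_poly.unlock.
apply: (@complexmx_inj R); rewrite /complexmx map_horner_mx map_mx0 rmorphXn /=.
rewrite -hp; set q := \prod_(z <- us) _.
suff /dvdpP[g ->] : \prod_(z <- rs) ('X - z%:P) %| q ^+ size rs.
  by rewrite rmorphM /= horner_mx_prod_XsubC -/(complexmx E) rs0 mulr0.
have : {subset rs <= us} by move=> z; rewrite mem_undup.
elim: (rs) => [|z l ih] h; first by rewrite big_nil dvd1p.
rewrite big_cons exprS dvdp_mul //; last first.
  by apply: ih => w wl; apply: h; rewrite inE wl orbT.
by rewrite dvdp_XsubCl root_prod_XsubC h // mem_head.
Qed.

(** The semisimple part is [f(E)], where [f] lifts the root ['X] of the separable
    annihilator; as a polynomial in [E] it commutes with all that commutes with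
    [E]. *)
Lemma jordan_decomposition n (E : 'M[R]_n) : exists S N : 'M[R]_n,
  [/\ E = S + N, semisimplemx S, nilpotentmx N &
      forall B, E *m B = B *m E -> S *m B = B *m S].
Proof.
case: n E => [|n] E.
  exists E, 0; split=> //; first by rewrite addr0.
    have -> : E = 0 by apply/matrixP => -[].
    by rewrite /semisimplemx /complexmx map_mx0; exact: diagonalizable0.
  by exists 1%N; rewrite expr1.
have [p [k [rs [cp Ek urs hp]]]] := separable_annihilator E.
have [f [pf pkf]] := separable_root_lift k cp.
set S := horner_mx E f; set N := E - S.
have Sp : horner_mx S p = 0.
  rewrite /S -horner_mx_comp; move/dvdpP: pkf => [g ->].
  by rewrite exprS !rmorphM /= Ek !mulr0.
have Nf : N = horner_mx E ('X - f) by rewrite rmorphB /= horner_mx_X.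
exists S, N; split.
- by rewrite subrKC.
- apply: (@diagonalizable_of_annihilator _ _ _ rs) => //.
  rewrite -horner_mx_prod_XsubC -hp /complexmx -map_horner_mx Sp.
  by rewrite map_mx0.
- exists k; rewrite Nf; move/dvdpP: pf => [g ->].
  by rewrite -rmorphXn exprMn rmorphM /= Ek mulr0.
- by move=> B EB; apply: comm_horner_mx.
Qed.

Lemma complexmxB n (A B : 'M[R]_n) : complexmx (A - B) = complexmx A - complexmx B.
Proof. exact: map_mxB. Qed.

Lemma complexmxD n (A B : 'M[R]_n) : complexmx (A + B) = complexmx A + complexmx B.
Proof. exact: map_mxD. Qed.

(** Any decomposition commutes with the one whose semisimple part is a polynomial
    in [E]; the difference of the two is then both semisimple and nilpotent. *)
Lemma nilpotent_part_unique n (E : 'M[R]_n) :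
  exists N, nilpotent_part E = [set N] /\
    forall B, E *m B = B *m E -> N *m B = B *m N.
Proof.
have [S [N [ESN ssS [k Nk] hS]]] := jordan_decomposition E.
have NE : N = E - S by rewrite ESN addrAC subrr add0r.
have hN B : E *m B = B *m E -> N *m B = B *m N.
  by move=> EB; rewrite NE mulmxBl mulmxBr EB hS.
exists N; split=> //; apply/seteqP; split=> [N' [S' [ESN' ssS' [l Nl] comm']]|_ ->].
  have ES' : E *m S' = S' *m E by rewrite ESN' mulmxDl mulmxDr comm'.
  have EN' : E *m N' = N' *m E by rewrite ESN' mulmxDl mulmxDr comm'.
  have e : S - S' = N' - N.
    have : S + N = S' + N' by rewrite -ESN -ESN'.
    by move=> /(congr1 (fun x => x - N - S')); rewrite addrK addrAC [S' + _]addrC addrK.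
  have nil : (N' - N) ^+ (l + k) = 0.
    by apply: nilpotent_sub => //; exact: esym (hN _ EN').
  have SS' : complexmx S *m complexmx S' = complexmx S' *m complexmx S.
    by rewrite /complexmx -!complexmxM hS.
  have d0 : complexmx (S - S') = 0.
    have := diagonalizableB SS' ssS ssS'; rewrite -complexmxB.
    move=> /(@diagonalizable_nilpotent_eq0 _ _ _ (l + k)); apply.
    by rewrite -complexmxX e nil /complexmx map_mx0.
  have : S - S' = 0 by apply: (@complexmx_inj R); rewrite d0 /complexmx map_mx0.
  by rewrite e => /eqP; rewrite subr_eq0 => /eqP.
exists S; split=> //; first by exists k.
have ES : E *m S = S *m E.
  by rewrite hS.
by rewrite -hN.
Qed.

End Jordan.

(** * Infinitesimal isometries of a definite form *)

Section Skew.
Variables (R : realType) (n : nat) (A W : 'M[R]_n).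
Local Notation C := R[i].
Local Notation toC := (real_complex R).
Hypothesis W_pos : forall x : 'rV[R]_n, x != 0 -> 0 < (x *m W *m x^T) 0 0.
Hypothesis A_skew : A *m W + W *m A^T = 0.

Let cj (v : 'rV[C]_n) : 'rV[C]_n := map_mx (@conjc R) v.
Let form (u v : 'rV[C]_n) : C := (u *m complexmx W *m (cj v)^T) 0 0.

Let formD u v w : form (u + v) w = form u w + form v w.
Proof. by rewrite /form !mulmxDl mxE. Qed.

Let formZ z u v : form (z *: u) v = z * form u v.
Proof. by rewrite /form -!scalemxAl mxE. Qed.

Let formZr z u v : form u (z *: v) = z^*%C * form u v.
Proof. by rewrite /form /cj map_mxZ linearZ /= -scalemxAr mxE. Qed.

Let form_skew u v : form (u *m complexmx A) v = - form u (v *m complexmx A).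
Proof.
rewrite /form.
have -> : (cj (v *m complexmx A))^T = (complexmx A)^T *m (cj v)^T.
  rewrite /cj map_mxM trmx_mul; congr (_^T *m _).
  by apply/matrixP => i j; rewrite !mxE /= oppr0.
have AW : complexmx A *m complexmx W = - (complexmx W *m (complexmx A)^T).
  apply/eqP; rewrite -addr_eq0 /complexmx map_trmx -!complexmxM -map_mxD A_skew.
  by rewrite map_mx0.
by rewrite -(mulmxA u) AW mulmxN mulNmx mxE !mulmxA.
Qed.

(** The real part of [form u u] is the sum of the values of the real form at the
    real and imaginary parts of [u]. *)
Let form_definite u : form u u = 0 -> u = 0.
Proof.
set a := map_mx (@complex.Re R) u; set b := map_mx (@complex.Im R) u => uu.
have re : (a *m W *m a^T) 0 0 + (b *m W *m b^T) 0 0 = 0.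
  have /(congr1 (@complex.Re R)) /= <- := uu.
  rewrite /form !mxE raddf_sum -big_split; apply: eq_bigr => k _ /=.
  rewrite !mxE !mulr_suml raddf_sum -big_split; apply: eq_bigr => l _ /=.
  rewrite !mxE; case: (u 0 l) => al bl; case: (u 0 k) => ak bk /=; ring.
have pos (x : 'rV[R]_n) : 0 <= (x *m W *m x^T) 0 0.
  have [->|x0] := eqVneq x 0; first by rewrite !mul0mx mxE.
  exact: ltW (W_pos x0).
have [a0|a0] := eqVneq a 0; last first.
  by have := ltr_wpDr (pos b) (W_pos a0); rewrite re ltxx.
have [b0|b0] := eqVneq b 0; last first.
  by have := ltr_wpDl (pos a) (W_pos b0); rewrite re ltxx.
apply/rowP => i; have /rowP/(_ i) := a0; have /rowP/(_ i) := b0; rewrite !mxE.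
by case: (u 0 i) => x y /= -> ->.
Qed.

(** Moving [A] across [form] changes its sign, so that [z] and minus its conjugate
    agree on an eigenvector. *)
Lemma skew_eigenvalue_Re0 z : eigenvalue (complexmx A) z -> complex.Re z = 0.
Proof.
move=> /eigenvalueP[v vA v0].
have : (z + z^*%C) * form v v = 0.
  by rewrite mulrDl -formZ -formZr -vA form_skew addNr.
move=> /eqP; rewrite mulf_eq0 => /orP[|/eqP/form_definite/eqP]; last first.
  by rewrite (negPf v0).
rewrite eq_complex => /andP[/eqP /= + _].
by case: z {vA} => x y /=; lra.
Qed.

(** A generalised eigenvector [v] of height 2 would make the eigenvector
    [w = v (A - z)] isotropic, because [z] is purely imaginary. *)
Lemma skew_semisimple : semisimplemx A.
Proof.
have [rs [hrs rs0]] := eigenvalue_annihilator (complexmx A).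
apply: (diagonalizable_of_height1 rs0) => z Y h.
apply/row_matrixP => i; rewrite row0.
set w := row i _.
have wA : w *m complexmx A = z *: w.
  apply/eqP; rewrite -subr_eq0 -mul_mx_scalar -mulmxBr /w -row_mul.
  by rewrite [X in row i X](_ : _ = 0) ?row0.
have [//|w0] := eqVneq w 0.
have ez : eigenvalue (complexmx A) z by apply/eigenvalueP; exists w.
have zz : z^*%C = - z.
  have := skew_eigenvalue_Re0 ez; case: (z) => x y /= ->.
  by apply/eqP; rewrite eq_complex /= oppr0 !eqxx.
apply: form_definite; set v := row i Y.
have wv : w = v *m complexmx A - z *: v.
  by rewrite /w row_mul mulmxBr mul_mx_scalar.
rewrite {1}wv -scaleNr formD formZ form_skew wA formZr zz; ring.
Qed.

End Skew.

(** * Laws of random matrices *)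

Section BorelMatrices.
Variable R : realType.

Lemma mxborel_open m n (U : set 'M[R]_(m, n)) : open U -> mxborel U.
Proof. by move=> oU; exact: sub_sigma_algebra. Qed.

Lemma mxborelC m n (B : set 'M[R]_(m, n)) : mxborel B -> mxborel (~` B).
Proof.
by move=> mB; rewrite -setTD; case: (smallest_sigma_algebra setT
  [set U : set 'M[R]_(m, n) | open U]) => _ h _; exact: h.
Qed.

Lemma mxborel_closed m n (C : set 'M[R]_(m, n)) : closed C -> mxborel C.
Proof.
move=> cC; rewrite -[C]setCK; apply: mxborelC; apply: mxborel_open.
exact: closed_openC.
Qed.

Lemma mxborel_preimage m n p q (f : 'M[R]_(m, n) -> 'M[R]_(p, q)) B :
  continuous f -> mxborel B -> mxborel (f @^-1` B).
Proof.
move=> cf; pose S := [set B : set 'M[R]_(p, q) | mxborel (f @^-1` B)].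
suff h : @mxborel R p q `<=` S by exact: h.
apply: smallest_sub => [|U oU]; last first.
  by apply: mxborel_open; apply: open_comp => // x _; exact: cf.
have [h0 hD hU] := smallest_sigma_algebra setT [set U : set 'M[R]_(m, n) | open U].
split; rewrite /S /=.
- by rewrite preimage_set0.
- by move=> A mA; rewrite setTD -preimage_setC; exact: mxborelC.
- by move=> F mF; rewrite preimage_bigcup; exact: hU.
Qed.

End BorelMatrices.

Section RandomMatrices.
Variables (R : realType) (d : measure_display) (T : measurableType d).

(** For one column this is [random_vector]. *)
Definition random_mx n k (Y : T -> 'M[R]_(n, k)) : Prop :=
  forall B, mxborel B -> measurable (Y @^-1` B).

Lemma random_mx_open n k (Y : T -> 'M[R]_(n, k)) :
  (forall U, open U -> measurable (Y @^-1` U)) -> random_mx Y.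
Proof.
move=> h; pose S := [set B : set 'M[R]_(n, k) | measurable (Y @^-1` B)].
suff hS : @mxborel R n k `<=` S by move=> B; exact: hS.
apply: smallest_sub => [|U oU]; last exact: h.
split; rewrite /S /=.
- by rewrite preimage_set0.
- by move=> A mA; rewrite setTD -preimage_setC; exact: measurableC.
- by move=> F mF; rewrite preimage_bigcup; exact: bigcupT_measurable.
Qed.

Lemma random_mx_continuous n k p q (f : 'M[R]_(n, k) -> 'M[R]_(p, q)) Y :
  continuous f -> random_mx Y -> random_mx (f \o Y).
Proof.
by move=> cf mY B mB; rewrite comp_preimage; apply: mY; exact: mxborel_preimage.
Qed.

Lemma continuous_norm_le n k p q (f : 'M[R]_(n, k) -> 'M[R]_(p, q)) (c : R) :
  (forall x y, `|f x - f y| <= c * `|x - y|) -> continuous f.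
Proof.
move=> h x; have Fx : Filter (nbhs x) by exact: nbhs_filter.
apply/(@cvgrPdist_le _ _ _ (nbhs x)) => e e0.
have c0 : 0 < Num.max c 1 by rewrite lt_max ltr01 orbT.
have := @nbhsx_ballx R 'M[R]_(n, k) x _ (divr_gt0 e0 c0).
apply: (@filterS _ (nbhs x) Fx) => y; rewrite -ball_normE /= => xy.
apply: le_trans (h _ _) _; apply: (@le_trans _ _ (Num.max c 1 * `|x - y|)).
  by rewrite ler_wpM2r // le_max lexx.
by rewrite mulrC -ler_pdivlMr // ltW.
Qed.

Lemma continuous_col n k j : continuous (fun M : 'M[R]_(n, k) => col j M).
Proof.
apply: (@continuous_norm_le _ _ _ _ _ 1) => x y; rewrite mul1r -raddfB.
by apply: norm_le => // i l; rewrite mxE entry_le_norm.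
Qed.

(** An open set is a countable union of balls with rational centres, and a ball
    of the sup norm is a product of balls of the column spaces. *)
Lemma random_mx_columns n k (Y : T -> 'M[R]_(n, k)) :
  (forall j, random_mx (fun w => col j (Y w))) -> random_mx Y.
Proof.
move=> h; apply: random_mx_open => U oU.
pose ctr (c : 'M[rat]_(n, k) * nat) : 'M[R]_(n, k) := map_mx ratr c.1.
pose rad (c : 'M[rat]_(n, k) * nat) : R := c.2.+1%:R^-1.
have rad0 c : 0 < rad c by rewrite invr_gt0.
pose F c := [set w | ball (ctr c) (rad c) `<=` U /\
  forall j, ball (col j (ctr c)) (rad c) (col j (Y w))].
have colball c M : (forall j, ball (col j (ctr c)) (rad c) (col j M)) <->
    ball (ctr c) (rad c) M.
  split=> [hj|[_ hM] j].
    by split=> // i j; have [_ /(_ i 0)] := hj j; rewrite 2![col _ _ _ _]mxE.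
  by split=> // i j0; rewrite 2![col _ _ _ _]mxE; exact: hM.
have -> : Y @^-1` U = \bigcup_c F c.
  apply/seteqP; split=> [w UYw|w [c _ [cU hc]]]; last first.
    by apply: cU; apply/colball.
  have /nbhs_ballP[e /= e0 eU] : nbhs (Y w) U by exact: open_nbhs_nbhs.
  have e20 : 0 < e / 2 by rewrite divr_gt0.
  pose r := Num.truncn (e / 2)^-1.
  have re : r.+1%:R^-1 < e / 2 :> R.
    by rewrite invf_plt ?posrE ?ltr0Sn // truncnS_gt.
  have r0 : 0 < r.+1%:R^-1 :> R by rewrite invr_gt0.
  have near_rat x : exists q : rat, `|ratr q - x| < r.+1%:R^-1 :> R.
    have lt1 : x - r.+1%:R^-1 < x + r.+1%:R^-1.
      by rewrite ltrBlDr -addrA ltrDl addr_gt0.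
    have [q] := rat_in_itvoo lt1; rewrite in_itv /= => /andP[q1 q2].
    by exists q; rewrite ltr_norml ltrBrDl q1 /= ltrBlDl.
  pose Q : 'M[rat]_(n, k) := \matrix_(i, j) xchoose (near_rat (Y w i j)).
  have bQ : ball (ctr (Q, r)) (rad (Q, r)) (Y w).
    split=> // i j; rewrite /ctr /= !mxE -ball_normE /=.
    exact: (xchooseP (near_rat (Y w i j))).
  exists (Q, r) => //; split; last by apply/colball.
  move=> M bM; apply: eU.
  apply: (@le_ball _ _ _ (rad (Q, r) + rad (Q, r))).
    by rewrite ltW // [ltRHS]splitr ltrD.
  by apply: ball_triangle bM; exact: ball_sym.
apply: countable_bigcupT_measurable => [|c]; first exact: countableP.
have [cU|ncU] := pselect (ball (ctr c) (rad c) `<=` U); last first.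
  by rewrite (_ : F c = set0) //; apply/seteqP; split=> // w [].
have -> : F c = \bigcap_(j in [set: 'I_k])
    ((fun w => col j (Y w)) @^-1` ball (col j (ctr c)) (rad c)).
  by apply/seteqP; split=> [w [_ hw] j _|w hw]; [exact: hw|split=> // j; exact: hw].
apply: fin_bigcap_measurable => // j _.
by apply: h; apply: mxborel_open; exact: ball_open.
Qed.

Lemma random_mx_row_mx n k l (Y : T -> 'M[R]_(n, k)) (Z : T -> 'M[R]_(n, l)) :
  random_mx Y -> random_mx Z -> random_mx (fun w => row_mx (Y w) (Z w)).
Proof.
move=> mY mZ; apply: random_mx_columns => j.
case: (split_ordP j) => i ->.
  under eq_fun do rewrite colKl.
  exact: (random_mx_continuous (@continuous_col _ _ i) mY).
under eq_fun do rewrite colKr.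
exact: (random_mx_continuous (@continuous_col _ _ i) mZ).
Qed.

Lemma closed_norm_ge n k (e : R) : closed [set M : 'M[R]_(n, k) | e <= `|M|].
Proof.
apply: (@preimage_closed _ _ (fun M : 'M[R]_(n, k) => `|M|) [set x | e <= x]).
  by move=> M _; exact: norm_continuous.
exact: closed_ge.
Qed.

Lemma measurable_dist_ge n k (Y Z : T -> 'M[R]_(n, k)) (e : R) :
  random_mx Y -> random_mx Z -> measurable [set w | e <= `|Y w - Z w|].
Proof.
move=> mY mZ; have mYZ := random_mx_row_mx mY mZ.
pose f (M : 'M[R]_(n, k + k)) := lsubmx M - rsubmx M.
have cf : continuous f.
  apply: (@continuous_norm_le _ _ _ _ _ 2) => x y.
  have -> : f x - f y = lsubmx (x - y) - rsubmx (x - y).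
    by apply/matrixP => i j; rewrite !mxE; ring.
  apply: le_trans (ler_normB _ _) _; rewrite mulr_natl mulr2n.
  by apply: lerD; apply: norm_le => // i j; rewrite mxE entry_le_norm.
have := mYZ _ (mxborel_preimage cf (mxborel_closed (@closed_norm_ge n k e))).
congr measurable; apply/seteqP.
by split=> w; rewrite /preimage /f /= row_mxKl row_mxKr.
Qed.

End RandomMatrices.

(** * Limits in probability of random matrices with equal laws *)

Section Laws.
Variables (R : realType) (d : measure_display) (T : measurableType d).
Variable P : probability T R.

(** With real values, so that probabilities obey linear arithmetic. *)
Definition pr (A : set T) : R := fine (P A).

Lemma prE A : measurable A -> P A = (pr A)%:E.
Proof. by move=> mA; rewrite /pr fineK // fin_num_measure. Qed.

Lemma pr_le A B : measurable A -> measurable B -> A `<=` B -> pr A <= pr B.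
Proof.
move=> mA mB AB; rewrite -lee_fin -!prE //.
by apply: le_measure => //; rewrite inE.
Qed.

Lemma pr_leU A B C : measurable A -> measurable B -> measurable C ->
  A `<=` B `|` C -> pr A <= pr B + pr C.
Proof.
move=> mA mB mC ABC; apply: le_trans (pr_le mA (measurableU _ _ mB mC) ABC) _.
rewrite -lee_fin EFinD -!prE //; last exact: measurableU.
exact: measureU2.
Qed.

Lemma pr_nonincreasing_lt (F : nat -> set T) A : (forall k, measurable (F k)) ->
  measurable A -> (forall k l, (k <= l)%N -> F l `<=` F k) ->
  \bigcap_k F k `<=` A -> forall e, 0 < e -> exists k, pr (F k) < pr A + e.
Proof.
move=> mF mA ndF FA e e0.
have mcap : measurable (\bigcap_k F k) by exact: bigcapT_measurable.
have : P \o F @ \oo --> P (\bigcap_k F k).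
  apply: nonincreasing_cvg_mu => //.
    by rewrite -ge0_fin_numE // fin_num_measure.
  by move=> k l kl; apply/subsetPset; exact: ndF.
rewrite (prE mcap) => /fine_cvgP[_ /cvgrPdist_lt/(_ _ e0)[N _ hN]].
exists N; have := hN N (leqnn N); rewrite /= distrC => /(le_lt_trans (ler_norm _)).
rewrite ltrBlDl -/(pr (F N)) => /lt_le_trans; apply.
by rewrite lerD2r pr_le.
Qed.

Definition law_eq n k (Y Z : T -> 'M[R]_(n, k)) : Prop :=
  forall B, mxborel B -> P (Y @^-1` B) = P (Z @^-1` B).

Lemma law_eq_trans n k (Y Z W : T -> 'M[R]_(n, k)) :
  law_eq Y Z -> law_eq Z W -> law_eq Y W.
Proof. by move=> YZ ZW B mB; rewrite YZ // ZW. Qed.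

Lemma law_eq_sym n k (Y Z : T -> 'M[R]_(n, k)) : law_eq Y Z -> law_eq Z Y.
Proof. by move=> YZ B mB; rewrite YZ. Qed.

Lemma law_eq_mulmx n k p (L : 'M[R]_(p, n)) (Y Z : T -> 'M[R]_(n, k)) :
  law_eq Y Z -> law_eq (fun w => L *m Y w) (fun w => L *m Z w).
Proof.
move=> YZ B mB.
exact: (YZ _ (mxborel_preimage (@continuous_mulmxl R _ _ _ L) mB)).
Qed.

Lemma random_mx_mulmx n k p (L : 'M[R]_(p, n)) (Y : T -> 'M[R]_(n, k)) :
  random_mx Y -> random_mx (fun w => L *m Y w).
Proof. exact: (random_mx_continuous (@continuous_mulmxl R _ _ _ L)). Qed.

Definition cvg_pr n k (Y : nat -> T -> 'M[R]_(n, k)) (Y0 : T -> 'M[R]_(n, k)) :=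
  forall e, 0 < e -> forall q, 0 < q -> exists N, forall j, (N <= j)%N ->
    pr [set w | e <= `|Y j w - Y0 w|] < q.

Definition thickening n k (C : set 'M[R]_(n, k)) (e : R) : set 'M[R]_(n, k) :=
  [set x | exists2 c, C c & `|c - x| < e].

Lemma open_thickening n k (C : set 'M[R]_(n, k)) e : open (thickening C e).
Proof.
have -> : thickening C e = \bigcup_(c in C) ball c e.
  by apply/seteqP; split=> x [c Cc cx]; exists c => //; move: cx; rewrite -ball_normE.
by apply: bigcup_open => c _; exact: ball_open.
Qed.

Lemma cap_thickening n k (C : set 'M[R]_(n, k)) : closed C ->
  \bigcap_j thickening C (2 * j.+1%:R^-1) `<=` C.
Proof.
move=> cC x hx; apply: cC => B /nbhs_ballP[e /= e0 eB].
have e20 : 0 < e / 2 by rewrite divr_gt0.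
pose r := Num.truncn (e / 2)^-1.
have re : r.+1%:R^-1 < e / 2 :> R.
  by rewrite invf_plt ?posrE ?ltr0Sn // truncnS_gt.
have [c Cc cx] := hx r I; exists c; split=> //; apply: eB.
rewrite -ball_normE /= distrC; apply: lt_trans cx _.
by rewrite mulrC -ltr_pdivlMr.
Qed.

(** Going from [Y0] to [Y j], from there to [Z j] by equality of laws, and on to
    [Z0] costs two thickenings of [C] and two small probabilities. *)
Lemma law_limit_closed n k (Y Z : nat -> T -> 'M[R]_(n, k)) Y0 Z0 C :
  (forall j, random_mx (Y j)) -> (forall j, random_mx (Z j)) ->
  random_mx Y0 -> random_mx Z0 -> (forall j, law_eq (Y j) (Z j)) ->
  cvg_pr Y Y0 -> cvg_pr Z Z0 -> closed C ->
  pr (Y0 @^-1` C) <= pr (Z0 @^-1` C).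
Proof.
move=> mY mZ mY0 mZ0 YZ YY0 ZZ0 cC; apply/ler_addgt0Pr => e e0.
have e30 : 0 < e / 3 by rewrite divr_gt0.
have mC : measurable (Z0 @^-1` C) by exact: (mZ0 _ (mxborel_closed cC)).
have [l hl] : exists l, pr (Z0 @^-1` thickening C (2 * l.+1%:R^-1))
    < pr (Z0 @^-1` C) + e / 3.
  apply: (@pr_nonincreasing_lt (fun l => Z0 @^-1` thickening C (2 * l.+1%:R^-1))) => //.
  - by move=> l; exact: (mZ0 _ (mxborel_open (@open_thickening n k C _))).
  - move=> a b ab w [c Cc cw]; exists c => //; apply: lt_le_trans cw _.
    apply: ler_wpM2l => //; rewrite lef_pV2 ?posrE ?ltr0Sn //.
    by rewrite ler_nat ltnS.
  - by move=> w hw; apply: cap_thickening => // l _; exact: hw.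
set r : R := l.+1%:R^-1; have r0 : 0 < r by rewrite invr_gt0.
have [N1 h1] := YY0 _ r0 _ e30; have [N2 h2] := ZZ0 _ r0 _ e30.
pose j := maxn N1 N2.
have := h1 j (leq_maxl _ _); have := h2 j (leq_maxr _ _).
have mth a : mxborel (thickening C a) by exact: (mxborel_open (@open_thickening n k C a)).
have YZj : pr (Y j @^-1` thickening C r) = pr (Z j @^-1` thickening C r).
  by rewrite /pr YZ.
have sub1 : Z j @^-1` thickening C r `<=`
   Z0 @^-1` thickening C (2 * r) `|` [set w | r <= `|Z j w - Z0 w|].
  move=> w [c Cc cw]; have [|] := leP r `|Z j w - Z0 w|; first by right.
  move=> wr; left; exists c => //.
  rewrite -(subrKA (Z j w)) (le_lt_trans (ler_normD _ _)) //.
  by rewrite mulr_natl mulr2n ltrD.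
have sub2 : Y0 @^-1` C `<=`
   Y j @^-1` thickening C r `|` [set w | r <= `|Y j w - Y0 w|].
  move=> w Cw; have [|] := leP r `|Y j w - Y0 w|; first by right.
  by move=> wr; left; exists (Y0 w) => //; rewrite distrC.
have m1 : measurable [set w | r <= `|Z j w - Z0 w|] by exact: measurable_dist_ge.
have m2 : measurable [set w | r <= `|Y j w - Y0 w|] by exact: measurable_dist_ge.
have := pr_leU (mZ j _ (mth r)) (mZ0 _ (mth (2 * r))) m1 sub1.
have := pr_leU (mY0 _ (mxborel_closed cC)) (mY j _ (mth r)) m2 sub2.
rewrite YZj; lra.
Qed.

(** Closed sets form a pi-system that generates the Borel sets. *)
Lemma law_eq_closed n k (Y Z : T -> 'M[R]_(n, k)) :
  random_mx Y -> random_mx Z ->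
  (forall C, closed C -> P (Y @^-1` C) = P (Z @^-1` C)) -> law_eq Y Z.
Proof.
move=> mY mZ h B mB; pose G := [set C : set 'M[R]_(n, k) | closed C].
have sub_borel : <<s G >> `<=` @mxborel R n k.
  apply: smallest_sub => [|C cC]; last exact: mxborel_closed.
  exact: smallest_sigma_algebra.
have GB : <<s G >> B.
  suff : @mxborel R n k `<=` <<s G >> by exact.
  apply: smallest_sub => [|U oU]; first exact: smallest_sigma_algebra.
  rewrite /= -[U]setCK -[X in _ X]setTD.
  case: (smallest_sigma_algebra setT G) => _ hC _; apply: hC.
  by apply: sub_sigma_algebra; exact: open_closedC.
apply: (@dynkin_induction _ (g_sigma_algebraType G) G
  (fun B => P (Y @^-1` B) = P (Z @^-1` B))) GB => //.
- by move=> A C cA cC; exact: closedI.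
- move=> S /sub_borel mS e; rewrite -!preimage_setC !probability_setC //.
  + by rewrite e.
  + exact: mZ.
  + exact: mY.
- move=> F mF tF e; rewrite !preimage_bigcup.
  have tr (f : T -> 'M[R]_(n, k)) : trivIset setT (fun i => f @^-1` F i).
    apply/trivIsetP => i j _ _ ij; rewrite -preimage_setI.
    by move/trivIsetP : tF => /(_ _ _ _ _ ij) ->//; rewrite preimage_set0.
  rewrite !measure_bigcup //; first by apply: eq_eseriesr => i _; exact: e.
  + by move=> i _; exact: (mZ _ (sub_borel _ (mF i))).
  + by move=> i _; exact: (mY _ (sub_borel _ (mF i))).
Qed.

Lemma law_eq_limit n k (Y Z : nat -> T -> 'M[R]_(n, k)) Y0 Z0 :
  (forall j, random_mx (Y j)) -> (forall j, random_mx (Z j)) ->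
  random_mx Y0 -> random_mx Z0 -> (forall j, law_eq (Y j) (Z j)) ->
  cvg_pr Y Y0 -> cvg_pr Z Z0 -> law_eq Y0 Z0.
Proof.
move=> mY mZ mY0 mZ0 YZ YY0 ZZ0; apply: law_eq_closed => // C cC.
have bC := mxborel_closed cC; rewrite !prE; [|exact: mZ0|exact: mY0].
congr EFin; apply/eqP; rewrite eq_le; apply/andP; split.
  exact: law_limit_closed YZ YY0 ZZ0 cC.
have ZY j : law_eq (Z j) (Y j) by exact: law_eq_sym (YZ j).
exact: law_limit_closed ZY ZZ0 YY0 cC.
Qed.

Lemma tight n k (Y : T -> 'M[R]_(n, k)) : random_mx Y ->
  forall q, 0 < q -> exists M : R, 0 < M /\ pr [set w | M <= `|Y w|] < q.
Proof.
move=> mY q q0.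
have mge (e : R) : measurable [set w | e <= `|Y w|].
  exact: (mY _ (mxborel_closed (@closed_norm_ge R n k e))).
have [N hN] : exists N, pr [set w | N.+1%:R <= `|Y w|] < pr set0 + q.
  apply: (@pr_nonincreasing_lt (fun N => [set w | N.+1%:R <= `|Y w|])) => //.
    by move=> a b ab w /=; apply: le_trans; rewrite ler_nat ltnS.
  move=> w hw; have := hw (Num.truncn `|Y w|) I.
  by rewrite /= leNgt truncnS_gt.
exists N.+1%:R; split=> //.
by move: hN; rewrite {2}/pr measure0 add0r.
Qed.

(** Tightness of [Y0] controls the error [(L j - L0) Y0]. *)
Lemma cvg_pr_mulmx n k p (L : nat -> 'M[R]_(p, n)) (L0 : 'M[R]_(p, n))
    (Y : nat -> T -> 'M[R]_(n, k)) Y0 :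
  (forall j, random_mx (Y j)) -> random_mx Y0 ->
  (forall e, 0 < e -> exists N, forall j, (N <= j)%N -> opn (L j - L0) < e) ->
  cvg_pr Y Y0 -> cvg_pr (fun j w => L j *m Y j w) (fun w => L0 *m Y0 w).
Proof.
move=> mY mY0 LL0 YY0 e e0 q q0.
have q20 : 0 < q / 2 by rewrite divr_gt0.
set K := opn L0 + 1; have K0 : 0 < K by rewrite ltr_wpDl ?opn_ge0.
have [M [M0 hM]] := tight mY0 q20.
have eK : 0 < e / (2 * K) by rewrite divr_gt0 ?mulr_gt0.
have eM : 0 < Num.min 1 (e / (2 * M)).
  by rewrite lt_min ltr01 divr_gt0 ?mulr_gt0.
have [N1 h1] := YY0 _ eK _ q20; have [N2 h2] := LL0 _ eM.
exists (maxn N1 N2) => j; rewrite geq_max => /andP[j1 j2].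
have := h2 j j2; rewrite lt_min => /andP[L1 LM].
have LK : opn (L j) <= K.
  have := opnD (L j - L0) L0; rewrite subrK => /le_trans; apply.
  by rewrite /K addrC lerD2l ltW.
apply: le_lt_trans (_ : _ <= pr [set w | e / (2 * K) <= `|Y j w - Y0 w|]
   + pr [set w | M <= `|Y0 w|]) _; last first.
  by rewrite [ltRHS]splitr ltrD // h1.
apply: pr_leU.
- apply: measurable_dist_ge; exact: random_mx_mulmx.
- exact: measurable_dist_ge.
- exact: (mY0 _ (mxborel_closed (@closed_norm_ge R n k M))).
move=> w /= ew.
have [|YM] := leP M `|Y0 w|; first by right.
have [|Yd] := leP (e / (2 * K)) `|Y j w - Y0 w|; first by left.
exfalso; move: ew; rewrite leNgt => /negP; apply.
have -> : L j *m Y j w - L0 *m Y0 w =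
  L j *m (Y j w - Y0 w) + (L j - L0) *m Y0 w.
  by rewrite mulmxBr mulmxBl subrKA.
rewrite (le_lt_trans (ler_normD _ _)) // [ltRHS]splitr; apply: ltr_leD.
  apply: le_lt_trans (norm_mulmx_le _ _) _.
  apply: (@le_lt_trans _ _ (K * `|Y j w - Y0 w|)).
    by rewrite ler_wpM2r.
  by move: Yd; rewrite invfM mulrA ltr_pdivlMr // mulrC.
apply: le_trans (norm_mulmx_le _ _) _.
apply: (@le_trans _ _ (e / (2 * M) * M)); last by rewrite invfM mulrA divfK ?gt_eqF.
by apply: ler_pM => //; [exact: opn_ge0 | exact: ltW | exact: ltW].
Qed.

End Laws.

(** * The graded group of a self-similar field *)

Section FieldGroup.
Variables (R : realType) (d : measure_display) (T : measurableType d).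
Variables (P : probability T R) (m n : nat).
Implicit Types X Z : 'cV[R]_m -> T -> 'cV[R]_n.

Definition joint X k (t : 'I_k -> 'cV[R]_m) : T -> 'M[R]_(n, k) :=
  fun w => \matrix_(i, j) X (t j) w i 0.

Lemma joint1 X t : joint X (fun _ : 'I_1 => t) = X t.
Proof. by apply/funext => w; apply/matrixP => i j; rewrite !mxE ord1. Qed.

Lemma fdd_eq_lawP X Z : fdd_eq P X Z <->
  forall k (t : 'I_k -> 'cV[R]_m), law_eq P (joint X t) (joint Z t).
Proof. by split. Qed.

Lemma joint_mulmx X (L : 'M[R]_n) k (t : 'I_k -> 'cV[R]_m) :
  joint (fun t w => L *m X t w) t = fun w => L *m joint X t w.
Proof.
apply/funext => w; apply/matrixP => i j; rewrite !mxE.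
by apply: eq_bigr => l _; rewrite mxE.
Qed.

Lemma random_joint X k (t : 'I_k -> 'cV[R]_m) :
  random_field X -> random_mx (joint X t).
Proof.
move=> mX; apply: random_mx_columns => j.
rewrite (_ : (fun w => _) = X (t j)); first exact: mX.
by apply/funext => w; apply/matrixP => i l; rewrite !mxE ord1.
Qed.

Lemma pr_le_sum (I : finType) (A : set T) (B : I -> set T) :
  measurable A -> (forall i, measurable (B i)) ->
  (forall w, A w -> exists i, B i w) -> pr P A <= \sum_i pr P (B i).
Proof.
move=> mA mB AB.
suff [mU hU] : measurable [set w | exists2 i, i \in enum I & B i w] /\
    pr P [set w | exists2 i, i \in enum I & B i w] <= \sum_(i <- enum I) pr P (B i).
  rewrite big_enum /= in hU; apply: le_trans hU; apply: pr_le => //.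
  by move=> w /AB[i Biw]; exists i => //; rewrite mem_enum.
elim: (enum I) => [|i r [mr ih]].
  have -> : [set w | exists2 i, i \in [::] & B i w] = set0.
    by apply/seteqP; split=> // w [].
  by split=> //; rewrite big_nil /pr measure0.
have -> : [set w | exists2 j, j \in i :: r & B j w] =
    B i `|` [set w | exists2 j, j \in r & B j w].
  apply/seteqP; split=> [w [j]|w [Biw|[j jr Bjw]]].
  - rewrite inE => /orP[/eqP -> ?|jr ?]; [by left|right; by exists j].
  - by exists i => //; rewrite mem_head.
  - by exists j => //; rewrite inE jr orbT.
split; first exact: measurableU.
have := pr_leU P (measurableU _ _ (mB i) mr) (mB i) mr (@subset_refl _ _).
by rewrite big_cons => /le_trans; apply; rewrite lerD2l.
Qed.

Lemma cvg_pr_joint X k (u : nat -> 'I_k -> 'cV[R]_m) (t : 'I_k -> 'cV[R]_m) :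
  random_field X -> stochastically_continuous P X ->
  (forall j, (fun l => u l j) @ \oo --> t j) ->
  cvg_pr P (fun l => joint X (u l)) (joint X t).
Proof.
move=> mX cX ut e e0 q q0.
have q1 : 0 < q / (k%:R + 1) by rewrite divr_gt0 // ltr_wpDl.
have mD j l : measurable [set w | e <= `|X (u l j) w - X (t j) w|].
  by apply: measurable_dist_ge; exact: mX.
have hN j : exists N, forall l, (N <= l)%N ->
    pr P [set w | e <= `|X (u l j) w - X (t j) w|] < q / (k%:R + 1).
  have /fine_cvgP[_ /cvgrPdist_lt/(_ _ q1)[N _ h]] := cX _ _ (ut j) _ e0.
  exists N => l Nl; have := h l Nl; rewrite /= sub0r normrN.
  exact: le_lt_trans (ler_norm _).
pose N j := sval (cid (hN j)).
exists (\max_j N j)%N => l Nl.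
apply: (@le_lt_trans _ _ (\sum_j pr P [set w | e <= `|X (u l j) w - X (t j) w|])).
  apply: pr_le_sum => //.
    by apply: measurable_dist_ge; exact: random_joint.
  move=> w /= ew; apply: contrapT => /forallNP h.
  have [k0|k0] := posnP k.
    move: ew; rewrite leNgt => /negP; apply; rewrite (le_lt_trans _ e0) //.
    by apply: norm_le => // i [j jk]; exfalso; rewrite k0 in jk.
  have lt j i : `|X (u l j) w i 0 - X (t j) w i 0| < e.
    have /negP := h j; rewrite -ltNge; apply: le_lt_trans.
    by have := entry_le_norm (X (u l j) w - X (t j) w) i 0; rewrite !mxE.
  have : `|joint X (u l) w - joint X t w| < e.
    have : forall j i, `|(joint X (u l) w - joint X t w) i j| < e.
      by move=> j i; rewrite !mxE.
    move=> lt'; rewrite [ltLHS]/Num.norm /= mx_normrE; apply/bigmax_ltP.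
    by split=> // -[i j] _; exact: lt'.
  by rewrite ltNge ew.
apply: (@le_lt_trans _ _ (\sum_(j < k) q / (k%:R + 1))).
  apply: ler_sum => j _; apply/ltW; rewrite /N in Nl.
  apply: (svalP (cid (hN j))); apply: leq_trans Nl.
  exact: (@leq_bigmax _ (fun j => sval (cid (hN j)))).
rewrite sumr_const card_ord -[ltLHS]mulr_natl mulrCA gtr_pMr //.
by rewrite ltr_pdivrMr ?ltr_wpDl // mul1r ltrDl.
Qed.

Lemma closed_norm_le0 p k : closed [set M : 'M[R]_(p, k) | `|M| <= 0].
Proof.
apply: (@preimage_closed _ _ (fun M : 'M[R]_(p, k) => `|M|) [set x | x <= 0]).
  by move=> M _; exact: norm_continuous.
exact: closed_le.
Qed.

Variables (X : 'cV[R]_m -> T -> 'cV[R]_n) (H : 'M[R]_n).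
Hypothesis mX : random_field X.
Hypothesis cX : stochastically_continuous P X.
Hypothesis ndX : ~ degenerate P X.

(** Scaling by [exp s], so that composition of scalings adds the parameters [s]. *)
Definition scaling_group (s : R) : set 'M[R]_m :=
  [set B | fdd_eq P (fun t => X (B *m t)) (fun t w => expmx (s *: H) *m X t w)].

Lemma scaling_groupP s B : scaling_group s B <->
  forall k (t : 'I_k -> 'cV[R]_m),
    law_eq P (joint X (fun j => B *m t j)) (fun w => expmx (s *: H) *m joint X t w).
Proof.
split=> [/fdd_eq_lawP h k t|h]; first by have := h k t; rewrite joint_mulmx.
by apply/fdd_eq_lawP => k t; rewrite joint_mulmx; exact: h.
Qed.

Lemma scaling_group0E : scaling_group 0 = domain_symmetries P X.
Proof.
rewrite /scaling_group /domain_symmetries scale0r expmx0.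
suff -> : (fun t w => 1 *m X t w) = X by [].
by apply/funext => t; apply/funext => w; rewrite mul1mx.
Qed.

Lemma domain_exponentsP E :
  domain_exponents P X H E <-> forall s, scaling_group s (expmx (s *: E)).
Proof.
split=> [h s|h c c0].
  by have := h (expR s) (expR_gt0 s); rewrite /powmx expRK.
exact: h (ln c).
Qed.

Let scaling_groupM s t A B :
  scaling_group s A -> scaling_group t B -> scaling_group (s + t) (A * B).
Proof.
move=> /scaling_groupP hA /scaling_groupP hB; apply/scaling_groupP => k u.
have -> : joint X (fun j => A * B *m u j) = joint X (fun j => A *m (B *m u j)).
  by congr joint; apply/funext => j; rewrite mulmxA.
apply: law_eq_trans (hA k (fun j => B *m u j)) _.
have -> : (fun w => expmx ((s + t) *: H) *m joint X u w) =
    (fun w => expmx (s *: H) *m (expmx (t *: H) *m joint X u w)).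
  by apply/funext => w; rewrite expmx_scaleD mulmxA.
exact: law_eq_mulmx (hB k u).
Qed.

Lemma expmx_mulKmx p k (A : 'M[R]_p) s (Y : 'M[R]_(p, k)) :
  expmx (- s *: A) *m (expmx (s *: A) *m Y) = Y.
Proof.
have e : expmx (- s *: A) *m expmx (s *: A) = 1%:M by exact: expmx_scaleNK.
by rewrite mulmxA e mul1mx.
Qed.

(** If [B] is singular, then [B] factors through the projection [pinvmx B *m B],
    and so does the field: the joint law of [X t] and [X (Q t)] is, up to an
    invertible matrix, that of [X (B t)] and [X (B Q t)], which coincide. *)
Let scaling_group_unit s B : scaling_group s B -> B \in unitmx.
Proof.
move=> /scaling_groupP hB; apply: contrapT => Bu; apply: ndX.
pose Q := pinvmx B *m B.
have BQ : B *m Q = B by rewrite /Q mulmxA mulmxKpV.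
exists Q; split.
- by rewrite /Q -[LHS]mulmxA BQ.
- by move=> Q1; apply: Bu; have [] := mulmx1_unit Q1.
move=> t.
pose tt (j : 'I_2) := if j == 0 then t else Q *m t.
pose diff (M : 'M[R]_(n, 2)) := col 0 M - col 1 M.
have cdiff : continuous diff.
  apply: (@continuous_norm_le _ _ _ _ _ _ 2) => x y.
  have -> : diff x - diff y = col 0 (x - y) - col 1 (x - y).
    by apply/matrixP => i j; rewrite !mxE; ring.
  apply: le_trans (ler_normB _ _) _; rewrite mulr_natl mulr2n.
  by apply: lerD; apply: norm_le => // i j; rewrite mxE entry_le_norm.
pose D : set 'M[R]_(n, 2) := diff @^-1` [set 0].
have mD : mxborel D.
  apply: mxborel_preimage => //; rewrite (_ : [set 0] = [set M | `|M| <= 0]).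
    exact: mxborel_closed (@closed_norm_le0 n 1).
  by apply/seteqP; split=> M /=; [move=> ->; rewrite normr0|rewrite normr_le0 => /eqP].
have := hB 2 tt D mD.
have -> : joint X (fun j => B *m tt j) @^-1` D = setT.
  apply/seteqP; split=> // w _; rewrite /D /diff /=.
  by apply/matrixP => i j; rewrite !mxE /tt /= mulmxA BQ subrr.
have cj w : diff (joint X tt w) = X t w - X (Q *m t) w.
  by apply/matrixP => i j; rewrite !mxE /tt ord1.
have -> : (fun w => expmx (s *: H) *m joint X tt w) @^-1` D =
    [set w | X t w = X (Q *m t) w].
  have dL (L : 'M[R]_n) M : diff (L *m M) = L *m diff M.
    by rewrite /diff !colE mulmxBr !mulmxA.
  apply/seteqP; split=> w; rewrite /D /= dL cj.
    move=> /(congr1 (mulmx (expmx (- s *: H)))); rewrite expmx_mulKmx mulmx0.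
    by move=> /eqP; rewrite subr_eq0 => /eqP.
  by move=> e; rewrite e subrr mulmx0.
rewrite probability_setT => /esym PA.
have mA : measurable [set w | X t w = X (Q *m t) w].
  have := random_joint tt mX mD; congr measurable.
  apply/seteqP; split=> w; rewrite /D /= cj; last by move=> ->; rewrite subrr.
  by move=> /eqP; rewrite subr_eq0 => /eqP.
exists (~` [set w | X t w = X (Q *m t) w]); split=> //.
  exact: measurableC.
by rewrite probability_setC // PA subee.
Qed.

(** Closedness rests on stochastic continuity: along converging matrices the field
    converges in probability, and equality of laws passes to the limit. *)
Lemma scaling_group_graded : closed_graded_group scaling_group.
Proof.
split.
- apply/scaling_groupP => k t B mB; rewrite scale0r expmx0; congr (P _).
  apply/seteqP; split=> w; rewrite /= mul1mx (_ : (fun j => 1 *m t j) = t) //.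
    by apply/funext => j; rewrite mul1mx.
  by apply/funext => j; rewrite mul1mx.
- exact: scaling_groupM.
- move=> s A FA; have Au := scaling_group_unit FA; split=> //.
  move/scaling_groupP : FA => hA; apply/scaling_groupP => k t.
  have := law_eq_mulmx (expmx (- s *: H)) (hA k (fun j => invmx A *m t j)).
  have -> : (fun j => A *m (invmx A *m t j)) = t.
    by apply/funext => j; rewrite mulKVmx.
  under [X in law_eq _ _ X]eq_fun do rewrite expmx_mulKmx.
  exact: law_eq_sym.
- move=> s A h; apply/scaling_groupP => k t.
  have hj (j : nat) : exists tB : R * 'M[R]_m,
     [/\ scaling_group tB.1 tB.2, `|tB.1 - s| < j.+1%:R^-1 & opn (tB.2 - A) < j.+1%:R^-1].
    have [|t0 [B [FB h1 h2]]] := h j.+1%:R^-1; first by rewrite invr_gt0.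
    by exists (t0, B).
  pose tB j := sval (cid (hj j)).
  have FB j : scaling_group (tB j).1 (tB j).2 by case: (svalP (cid (hj j))).
  have small (e : R) : 0 < e -> exists N, forall j, (N <= j)%N -> j.+1%:R^-1 < e.
    move=> e0; exists (Num.truncn e^-1) => j Nj.
    rewrite invf_plt ?posrE ?ltr0Sn //; apply: lt_le_trans (truncnS_gt _) _.
    by rewrite ler_nat ltnS.
  apply: (@law_eq_limit _ _ _ P _ _
    (fun j => joint X (fun i => (tB j).2 *m t i))
    (fun j w => expmx ((tB j).1 *: H) *m joint X t w)).
  + by move=> j; exact: random_joint.
  + by move=> j; apply: random_mx_mulmx; exact: random_joint.
  + exact: random_joint.
  + by apply: random_mx_mulmx; exact: random_joint.
  + by move=> j; have /scaling_groupP := FB j; apply.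
  + apply: cvg_pr_joint => // i; apply/cvg_opnP => e e0.
    have c0 : 0 < opn (t i) + 1 by rewrite ltr_wpDl ?opn_ge0.
    have [N hN] := small _ (divr_gt0 e0 c0).
    exists N => // j /= /hN jN; rewrite -mulmxBl.
    apply: le_lt_trans (opnM _ _) _.
    have [_ _ hB] := svalP (cid (hj j)); rewrite -/(tB j) in hB.
    have := lt_trans hB jN; rewrite ltr_pdivlMr //; apply: le_lt_trans.
    by rewrite ler_wpM2l ?opn_ge0 // lerDl.
  + apply: cvg_pr_mulmx; first by move=> j; exact: random_joint.
    * exact: random_joint.
    * move=> e e0; have [q q0 hq] := expmx_scale_continuous H s e0.
      have [N hN] := small _ q0; exists N => j /hN jN; apply: hq.
      have [_ hB _] := svalP (cid (hj j)); rewrite -/(tB j) in hB.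
      exact: lt_trans hB jN.
    * move=> e e0 q q0; exists 0%N => j _.
      rewrite (_ : [set _ | _] = set0) ?/pr ?measure0 //.
      by apply/seteqP; split=> // w /=; rewrite subrr normr0 leNgt e0.
Qed.

End FieldGroup.

(** * Boundedness of the symmetry group *)

Section Bounded.
Variable R : realType.

(** The sum of absolute values along a row is attained at its vector of signs. *)
Lemma opn_gt_attained m n (B : 'M[R]_(m, n)) (c : R) : 0 <= c -> c < opn B ->
  exists t : 'cV[R]_n, `|t| <= 1 /\ c < `|B *m t|.
Proof.
move=> c0 cB; have [i hi] : exists i, c < \sum_j `|B i j|.
  apply: contrapT => /forallNP h; move: cB; rewrite ltNge => /negP; apply.
  by apply: opn_le => // i; have /negP := h i; rewrite -leNgt.
exists (\col_j Num.sg (B i j)); split.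
  by apply: norm_le => // j l; rewrite mxE normr_sg; case: (_ != 0).
apply: lt_le_trans hi _; apply: le_trans (entry_le_norm _ i 0).
rewrite mxE; apply: le_trans (ler_norm _); apply: ler_sum => j _.
by rewrite mxE normrEsg mulrC.
Qed.

(** For limits it is enough that [f j] dominates [j], so that [f] is not required
    to increase. *)
Lemma bounded_subsequence p (u : nat -> 'cV[R]_p) : (forall k, `|u k| <= 1) ->
  exists (f : nat -> nat) (x : 'cV[R]_p), (forall j, (j <= f j)%N) /\
    (fun j => u (f j)) @ \oo --> x.
Proof.
move=> u1; pose K := [set x : 'rV[R]_p | `|x| <= 1].
have cK : compact K.
  apply: bounded_closed_compact.
    by exists 1; split=> // M M1 x /= x1; rewrite (le_trans x1) // ltW.
  apply: (@preimage_closed _ _ (fun M : 'rV[R]_p => `|M|) [set x | x <= 1]).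
    by move=> M _; exact: norm_continuous.
  exact: closed_le.
have trn (x : 'cV[R]_p) : `|x^T| <= `|x|.
  by apply: norm_le => // i j; rewrite mxE entry_le_norm.
have trn' (x : 'rV[R]_p) : `|x^T| <= `|x|.
  by apply: norm_le => // i j; rewrite mxE entry_le_norm.
have [|x [Kx cx]] := cK ((fun k => (u k)^T) @ \oo) _.
  by exists 0%N => // k _ /=; exact: le_trans (trn _) (u1 k).
have hj (j : nat) : exists k, (j <= k)%N /\ `|u k - x^T| < j.+1%:R^-1.
  have j0 : 0 < j.+1%:R^-1 :> R by rewrite invr_gt0.
  have A1 : ((fun k => (u k)^T) @ \oo) [set y | exists2 k, (j <= k)%N & y = (u k)^T].
    by exists j => // k /= jk; exists k.
  have [y [[k jk ->]]] := cx _ _ A1 (@nbhsx_ballx R 'rV[R]_p x _ j0).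
  rewrite -ball_normE /= => xk; exists k; split=> //.
  rewrite distrC; apply: le_lt_trans xk.
  by rewrite -[X in _ <= `|X - _|]trmxK -raddfB /= -[X in `|X| <= _]trmxK; exact: trn'.
exists (fun j => sval (cid (hj j))), x^T; split.
  by move=> j; case: (svalP (cid (hj j))).
apply/cvgrPdistC_lt => e e0; exists (Num.truncn e^-1) => // j /= Nj.
have [_ /lt_trans] := svalP (cid (hj j)); apply.
rewrite invf_plt ?posrE ?ltr0Sn //; apply: lt_le_trans (truncnS_gt _) _.
by rewrite ler_nat ltnS.
Qed.

(** By the intermediate value theorem: the norm exceeds 1 at [s = 0] and decays
    to 0. *)
Lemma expmx_orbit_meets_sphere p (E : 'M[R]_p) (y : 'cV[R]_p) :
  (forall x, real_spectrum E x -> 0 < x) -> 1 < `|y| ->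
  exists2 s, 0 <= s & `|expmx (- s *: E) *m y| = 1.
Proof.
move=> hE y1; have y0 : 0 < `|y| by rewrite (lt_trans ltr01).
have [s0 hs0] := expmx_decay hE (divr_gt0 ltr01 y0).
set S := Num.max 0 s0; have S0 : 0 <= S by rewrite le_max lexx.
pose g (s : R) := `|expmx (- s *: E) *m y|.
have gS : g S < 1.
  apply: le_lt_trans (norm_mulmx_le _ _) _.
  by rewrite -ltr_pdivlMr // hs0 // le_max lexx orbT.
have g0 : g 0 = `|y| by rewrite /g oppr0 scale0r expmx0 mul1mx.
have cg : continuous g.
  move=> s; apply/cvgrPdist_lt => e e0.
  have [q q0 hq] := expmx_scale_continuous E (- s) (divr_gt0 e0 y0).
  apply: (filterS _ (@nbhsx_ballx R R s _ q0)) => t; rewrite -ball_normE /= => st.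
  apply: le_lt_trans (ler_dist_dist _ _) _; rewrite -mulmxBl.
  apply: le_lt_trans (norm_mulmx_le _ _) _; rewrite -ltr_pdivlMr //.
  by rewrite opnC hq // opprK addrC.
have [s] : exists2 s, s \in `[0, S]%R & g s = 1.
  apply: IVT => //; first exact: continuous_subspaceT.
  by rewrite g0 ge_min (ltW gS) orbT /= le_max (ltW y1).
by rewrite in_itv /= => /andP[s_ge0 _] gs; exists s.
Qed.

Variables (d : measure_display) (T : measurableType d).
Variables (P : probability T R) (m n : nat).
Variables (X : 'cV[R]_m -> T -> 'cV[R]_n) (E : 'M[R]_m) (H : 'M[R]_n).
Hypothesis mX : random_field X.
Hypothesis pX : proper_field P X.
Hypothesis ndX : ~ degenerate P X.
Hypothesis cX : stochastically_continuous P X.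
Hypothesis hE : forall x, real_spectrum E x -> 0 < x.
Hypothesis hH : forall x, real_spectrum H x -> 0 < x.
Hypothesis EH : domain_exponents P X H E.

Lemma proper_law_neq0 t : t != 0 -> law_eq P (X t) (fun _ => 0) -> (0 < n)%N -> False.
Proof.
move=> t0 lX n0; pose i : 'I_n := Ordinal n0.
pose a : 'rV[R]_n := delta_mx 0 i.
have a0 : a != 0.
  by apply/eqP => /matrixP/(_ 0 i); rewrite !mxE !eqxx => /eqP; rewrite oner_eq0.
apply: (pX t0 (a := a) (b := 0) a0).
pose D : set 'cV[R]_n := (fun M => a *m M) @^-1` [set N | `|N| <= 0].
have mD : mxborel D.
  apply: mxborel_preimage; first exact: continuous_mulmxl.
  exact: mxborel_closed (@closed_norm_le0 R 1 1).
have -> : [set w | (a *m X t w) 0 0 = 0] = X t @^-1` D.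
  apply/seteqP; split=> w; rewrite /D /= normr_le0.
    move=> e; apply/eqP/matrixP => k l; rewrite [k]ord1 [l]ord1 e mxE //.
  by move=> /eqP ->; rewrite mxE.
rewrite lX // (_ : _ @^-1` D = setT) ?probability_setT //.
by apply/seteqP; split=> // w _; rewrite /D /= mulmx0 normr0.
Qed.

(** For [n = 0] the field is constant, hence factors through the projection 0. *)
Lemma field_dim_gt0 : (0 < m)%N -> (0 < n)%N.
Proof.
move=> m0; rewrite lt0n; apply/eqP => n0; apply: ndX; exists 0; split.
- by rewrite mul0mx.
- move=> /matrixP/(_ (Ordinal m0) (Ordinal m0)).
  by rewrite !mxE eqxx => /esym/eqP; rewrite oner_eq0.
- move=> t; apply: aeW => w; apply/matrixP => -[i hi] j.
  by exfalso; rewrite n0 in hi.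
Qed.

(** If symmetries [B j] were unbounded, they would send points [t j] of the unit
    ball to points [exp (s j E) v j] with [v j] on the unit sphere and [s j]
    tending to infinity.  Then [X (v j)] has the law of [exp (- s j H) X (t j)],
    which tends to 0, although limit points of the [v j] are nonzero. *)
Lemma domain_symmetries_bounded :
  exists c, forall B, domain_symmetries P X B -> opn B <= c.
Proof.
have [m0|m0] := posnP m.
  exists 0 => B _; apply: opn_le => // -[i hi]; exfalso; by rewrite m0 in hi.
apply: contrapT => /forallNP hunb.
have hj (j : nat) : exists x : 'cV[R]_m * (R * 'cV[R]_m), [/\ `|x.1| <= 1,
    `|x.2.2| = 1, j%:R + 1 < expR (x.2.1 * opn E) &
    law_eq P (fun w => expmx (- x.2.1 *: H) *m X x.1 w) (X x.2.2)].
  have /existsNP[B /not_implyP[GB /negP]] := hunb (j%:R + 1).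
  rewrite -ltNge => Bj; have j0 : 0 <= j%:R + 1 :> R by rewrite addr_ge0.
  have [t [t1 Bt]] := opn_gt_attained j0 Bj.
  have yt : 1 < `|B *m t| by apply: le_lt_trans Bt; rewrite lerDr.
  have [s s0 hs] := expmx_orbit_meets_sphere hE yt.
  set v := expmx (- s *: E) *m (B *m t) in hs.
  have Bv : B *m t = expmx (s *: E) *m v.
    by have := expmx_mulKmx E (- s) (B *m t); rewrite opprK.
  exists (t, (s, v)); split=> //=.
    apply: lt_le_trans Bt _; rewrite Bv; apply: le_trans (norm_mulmx_le _ _) _.
    rewrite hs mulr1; apply: le_trans (opn_expmx _) _; rewrite ler_expR.
    by apply: le_trans (opnZ _ _) _; rewrite ger0_norm.
  have /scaling_groupP/(_ 1%N (fun=> v)) := (domain_exponentsP P X H E).1 EH s.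
  rewrite !joint1 -Bv => lE.
  rewrite -(scaling_group0E P X H) in GB.
  have /scaling_groupP/(_ 1%N (fun=> t)) := GB.
  rewrite !joint1 scale0r expmx0 => lB.
  have lt : law_eq P (X t) (fun w => expmx (s *: H) *m X v w).
    apply: law_eq_trans lE; apply: law_eq_sym.
    by under [X in law_eq _ _ X]eq_fun do rewrite -[X t _]mul1mx.
  have := law_eq_mulmx (expmx (- s *: H)) lt.
  by under [X in law_eq _ _ X]eq_fun do rewrite expmx_mulKmx.
pose x j := sval (cid (hj j)).
have hx j : [/\ `|(x j).1| <= 1, `|(x j).2.2| = 1, j%:R + 1 < expR ((x j).2.1 * opn E) &
    law_eq P (fun w => expmx (- (x j).2.1 *: H) *m X (x j).1 w) (X (x j).2.2)].
  exact: (svalP (cid (hj j))).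
have [|f [z [fj uz]]] := @bounded_subsequence _ (fun j => col_mx (x j).1 (x j).2.2).
  move=> j; have [x1 x2 _ _] := hx j; apply: norm_le => // i k; rewrite mxE.
  case: splitP => l _; first exact: le_trans (entry_le_norm _ _ _) x1.
  by apply: le_trans (entry_le_norm _ _ _) _; rewrite x2.
have cvg1 : (fun j => (x (f j)).1) @ \oo --> usubmx z.
  apply/cvgrPdistC_lt => e e0; move/cvgrPdistC_lt/(_ _ e0) : uz.
  apply: filterS => j; apply: le_lt_trans.
  have -> : (x (f j)).1 - usubmx z = usubmx (col_mx (x (f j)).1 (x (f j)).2.2 - z).
    by rewrite raddfB /= col_mxKu.
  by apply: norm_le => // i k; rewrite mxE entry_le_norm.
have cvg2 : (fun j => (x (f j)).2.2) @ \oo --> dsubmx z.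
  apply/cvgrPdistC_lt => e e0; move/cvgrPdistC_lt/(_ _ e0) : uz.
  apply: filterS => j; apply: le_lt_trans.
  have -> : (x (f j)).2.2 - dsubmx z = dsubmx (col_mx (x (f j)).1 (x (f j)).2.2 - z).
    by rewrite raddfB /= col_mxKd.
  by apply: norm_le => // i k; rewrite mxE entry_le_norm.
have z0 : dsubmx z != 0.
  apply/eqP => z0; move/cvgrPdistC_lt/(_ _ ltr01) : cvg2 => [N _ /(_ N (leqnn N))] /=.
  by rewrite z0 subr0; have [_ -> _ _] := hx (f N); rewrite ltxx.
apply: (proper_law_neq0 z0); last exact: field_dim_gt0.
apply: law_eq_sym.
suff : law_eq P (fun w => 0 *m X (usubmx z) w) (X (dsubmx z)).
  by under [X in law_eq _ X _]eq_fun do rewrite mul0mx.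
have col_cvg (u : nat -> 'cV[R]_m) (t : 'cV[R]_m) : u @ \oo --> t ->
    cvg_pr P (fun j => X (u j)) (X t).
  move=> ut; have := @cvg_pr_joint _ _ _ P _ _ X 1 (fun j _ => u j) (fun=> t) mX cX.
  rewrite joint1 (_ : (fun l => joint X (fun=> u l)) = (fun j => X (u j))).
    by apply.
  by apply/funext => j; rewrite joint1.
apply: (@law_eq_limit _ _ _ P _ _
  (fun j w => expmx (- (x (f j)).2.1 *: H) *m X (x (f j)).1 w)
  (fun j => X (x (f j)).2.2)).
- by move=> j; apply: random_mx_mulmx; exact: mX.
- by move=> j; exact: mX.
- by apply: random_mx_mulmx; exact: mX.
- exact: mX.
- by move=> j; have [] := hx (f j).
- apply: cvg_pr_mulmx; [by move=> j; exact: mX | exact: mX | | exact: col_cvg].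
  move=> e e0; have [s0 hs0] := expmx_decay hH e0.
  exists (Num.truncn (expR (s0 * opn E))).+1 => j Nj; rewrite subr0; apply: hs0.
  rewrite leNgt; apply/negP => ss0; have [_ _ + _] := hx (f j).
  apply/negP; rewrite -leNgt; apply: (@le_trans _ _ (expR (s0 * opn E))).
    by rewrite ler_expR ler_wpM2r ?opn_ge0 // ltW.
  apply/ltW/(lt_le_trans (truncnS_gt _)); apply: (@le_trans _ _ (f j)%:R).
    by rewrite ler_nat (leq_trans Nj).
  by rewrite lerDl.
- exact: col_cvg.
Qed.

End Bounded.

(** * Exponents of a closed graded group with bounded degree zero part *)

Section Exponents.
Variables (R : realType) (p : nat) (F : R -> set 'M[R]_p).
Hypothesis gF : closed_graded_group F.
Hypothesis F0_bounded : exists c, forall B, F 0 B -> opn B <= c.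

Definition exponent (E : 'M[R]_p) : Prop := forall s, F s (expmx (s *: E)).

Lemma opn_small_eq0 m n (Y : 'M[R]_(m, n)) (K : R) :
  (forall e, 0 < e -> e <= 1 -> opn Y <= K * e) -> Y = 0.
Proof.
move=> h; apply/matrixP => i j; apply/eqP; rewrite [X in _ == X]mxE -normr_le0.
apply: le_trans (entry_le_opn _ i j) _; apply/ler_addgt0Pr => e e0; rewrite add0r.
have K0 : 0 < `|K| + 1 by rewrite ltr_wpDl.
set q := Num.min 1 (e / (`|K| + 1)).
have q0 : 0 < q by rewrite lt_min ltr01 divr_gt0.
have q1 : q <= 1 by rewrite ge_min lexx.
have qe : q <= e / (`|K| + 1) by rewrite ge_min lexx orbT.
apply: le_trans (h q q0 q1) _.
rewrite ler_pdivlMr // in qe; apply: le_trans qe.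
rewrite mulrC; apply: ler_wpM2l; first exact: ltW.
by rewrite (le_trans (ler_norm K)) // lerDl.
Qed.

Lemma tangent_space_approx (G : set 'M[R]_p) A : tangent_space G A ->
  forall e, 0 < e -> exists g s,
    [/\ G g, s != 0, `|s| < e & opn (s^-1 *: (g - 1%:M) - A) < e].
Proof.
move=> [g [s [Gg s0 scv gcv]]] e e0.
have [N1 _ h1] : \forall j \near \oo, `|s j| < e by move/cvgr0Pnorm_lt : scv; exact.
have [N2 _ h2] := (cvg_opnP _ _).1 gcv _ e0.
exists (g (maxn N1 N2)), (s (maxn N1 N2)); split=> //.
  by apply: h1; exact: leq_maxl.
by apply: h2; exact: leq_maxr.
Qed.

(** The product rule at the unit, with an explicit error. *)
Lemma first_order_mul (U V A B : 'M[R]_p) (s e : R) : 0 <= e -> e <= 1 ->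
  `|s| <= e -> opn (U - 1 - s *: A) <= e * `|s| ->
  opn (V - 1 - s *: B) <= e * `|s| ->
  opn (U * V - 1 - s *: (A + B)) <= ((opn A + 1) * (opn B + 1) + 2) * e * `|s|.
Proof.
move=> e0 e1 se hU hV; set a := opn A; set b := opn B.
have a0 : 0 <= a := opn_ge0 A; have b0 : 0 <= b := opn_ge0 B.
have s1 : `|s| <= 1 by exact: le_trans e1.
have hV1 : opn (V - 1) <= `|s| * (b + 1).
  rewrite -[V - 1](subrK (s *: B)); apply: le_trans (opnD _ _) _.
  rewrite mulrDr mulr1 addrC; apply: lerD; first exact: opnZ.
  by apply: le_trans hV _; rewrite ler_piMl.
have hVn : opn V <= b + 2.
  rewrite -[V](subrK 1); apply: le_trans (opnD _ _) _.
  have := opn1 R p; have : `|s| * (b + 1) <= b + 1 by rewrite ler_piMl // addr_ge0.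
  lra.
have -> : U * V - 1 - s *: (A + B) =
    (U - 1 - s *: A) * V + (s *: A) * (V - 1) + (V - 1 - s *: B).
  by rewrite !mulrBl mul1r mulrBr mulr1 subrKA addrACA subrKA scalerDr opprD.
apply: le_trans (opnD _ _) _.
apply: (@le_trans _ _ ((e * `|s| * (b + 2) + e * a * (`|s| * (b + 1))) + e * `|s|)).
  apply: lerD => //; apply: le_trans (opnD _ _) _; apply: lerD.
    by apply: le_trans (opnM _ _) _; apply: ler_pM; rewrite ?opn_ge0.
  apply: le_trans (opnM _ _) _; apply: ler_pM; rewrite ?opn_ge0 //.
  by apply: le_trans (opnZ _ _) _; rewrite ler_wpM2r.
have := mulr_ge0 e0 (normr_ge0 s); set x := `|s|; move=> ex0.
rewrite [leLHS](_ : _ = (b + 2 + a * (b + 1) + 1) * (e * x)); last by ring.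
rewrite -[leRHS]mulrA ler_wpM2r //.
lra.
Qed.

Lemma expmx_first_order (E : 'M[R]_p) (e : R) : 0 < e -> exists2 q, 0 < q &
  forall s, `|s| < q -> opn (expmx (s *: E) - 1 - s *: E) <= e * `|s|.
Proof.
move=> e0; set K := opn E ^+ 2 * expR (opn E).
have K0 : 0 <= K by rewrite mulr_ge0 ?expR_ge0 ?sqr_ge0.
exists (Num.min 1 (e / (K + 1))); first by rewrite lt_min ltr01 divr_gt0 // ltr_wpDl.
move=> s; rewrite lt_min => /andP[s1 sK].
apply: le_trans (opn_expmx_sub1D _) _.
have hs : opn (s *: E) <= `|s| * opn E by exact: opnZ.
apply: (@le_trans _ _ (`|s| * K * `|s|)).
  rewrite [leRHS](_ : _ = (`|s| * opn E) ^+ 2 * expR (opn E)); last by rewrite /K; ring.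
  apply: ler_pM; rewrite ?sqr_ge0 ?expR_ge0 //.
    by rewrite lerXn2r ?nnegrE ?opn_ge0 // mulr_ge0 ?opn_ge0.
  by rewrite ler_expR (le_trans hs) // ler_piMl ?opn_ge0 // ltW.
rewrite ler_wpM2r //; move: sK; rewrite ltr_pdivlMr ?ltr_wpDl // => /ltW.
by apply: le_trans; rewrite ler_wpM2l // lerDl.
Qed.

(** If [g] approximates [1 + s A], then [exp (s E) * g] approximates
    [1 + s (E + A)]. *)
Lemma exponentD E A : exponent E -> tangent_space (F 0) A -> exponent (E + A).
Proof.
move=> FE TA; apply: graded_exp => // e e0.
set K := (opn E + 1) * (opn A + 1) + 2.
have K0 : 0 < K by rewrite ltr_wpDl // mulr_ge0 // addr_ge0 ?opn_ge0.
set e1 := Num.min (Num.min 1 e) (e / K).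
have e10 : 0 < e1 by rewrite !lt_min ltr01 e0 divr_gt0.
have [e11 e1e e1K] : [/\ e1 <= 1, e1 <= e & K * e1 <= e].
  split; rewrite ?ge_min ?lexx ?orbT //.
  by rewrite mulrC -ler_pdivlMr // ge_min lexx orbT.
clearbody e1; have [q q0 hq] := expmx_first_order E e10.
have [|g [s [Gg s0 sq hg]]] := tangent_space_approx TA (e := Num.min e1 q).
  by rewrite lt_min e10.
move: sq hg; rewrite !lt_min => /andP[se sq] /andP[hg _].
exists s, (expmx (s *: E) * g); split=> //.
- by rewrite -[s in F s]addr0; exact: gradedM (FE s) Gg.
- exact: lt_le_trans se e1e.
apply: le_trans (first_order_mul (ltW e10) e11 (ltW se) (hq s sq) _) _.
  have -> : g - 1 - s *: A = s *: (s^-1 *: (g - 1%:M) - A).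
    by rewrite scalerBr scalerA divff // scale1r.
  by apply: le_trans (opnZ _ _) _; rewrite mulrC ler_wpM2r // ltW.
by rewrite ler_wpM2r.
Qed.

(** The curve [exp (s E') exp (- s E)] stays in [F 0]; its velocity at 0 is
    [E' - E]. *)
Lemma exponentB E E' : exponent E -> exponent E' -> tangent_space (F 0) (E' - E).
Proof.
move=> FE FE'; pose s (j : nat) : R := j.+1%:R^-1.
have s0 j : 0 < s j by rewrite invr_gt0.
exists (fun j => expmx (s j *: E') * expmx (- s j *: E)), s; split.
- by move=> j; have := gradedM gF (FE' (s j)) (FE (- s j)); rewrite addrN.
- by move=> j; rewrite gt_eqF.
- exact: cvg_harmonic.
apply/cvg_opnP => e e0.
set K := (opn E' + 1) * (opn (- E) + 1) + 2.
have K0 : 0 < K by rewrite ltr_wpDl // mulr_ge0 // addr_ge0 ?opn_ge0.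
set e1 := Num.min 1 (e / 2 / K).
have e10 : 0 < e1 by rewrite !lt_min ltr01 !divr_gt0.
have [e11 e1K] : e1 <= 1 /\ K * e1 <= e / 2.
  split; rewrite ?ge_min ?lexx ?orbT //.
  by rewrite mulrC -ler_pdivlMr // ge_min lexx orbT.
clearbody e1; have [q q0 hq] := expmx_first_order E e10.
have [q' q'0 hq'] := expmx_first_order E' e10.
have m0 : 0 < Num.min e1 (Num.min q q') by rewrite !lt_min e10 q0.
near=> j.
have : `|s j| < Num.min e1 (Num.min q q').
  by near: j; have := @cvg_harmonic R; move/cvgr0Pnorm_lt; exact.
rewrite !lt_min => /and3P[se sq sq'].
have sn : `|s j| != 0 by rewrite normr_eq0 gt_eqF.
have hE : opn (expmx (- s j *: E) - 1 - s j *: (- E)) <= e1 * `|s j|.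
  by have := hq (- s j); rewrite normrN scalerN -scaleNr; apply.
have := first_order_mul (ltW e10) e11 (ltW se) (hq' _ sq') hE.
set Y := _ * _ => hY.
have -> : (s j)^-1 *: (Y - 1%:M) - (E' - E) = (s j)^-1 *: (Y - 1 - s j *: (E' - E)).
  by rewrite [RHS]scalerBr scalerA mulVf ?scale1r // gt_eqF.
apply: le_lt_trans (opnZ _ _) _; rewrite normfV mulrC ltr_pdivrMr ?normr_gt0 ?gt_eqF //.
apply: le_lt_trans hY _; rewrite ltr_pM2r ?normr_gt0 ?gt_eqF //.
apply: le_lt_trans e1K _; lra.
Unshelve. all: by end_near. Qed.

Lemma tangent_space_half (G : set 'M[R]_p) A :
  tangent_space G A -> tangent_space G (2^-1 *: A).
Proof.
move=> [g [s [Gg s0 scv gcv]]]; exists g, (fun j => 2 * s j); split=> //.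
- by move=> j; rewrite mulf_neq0.
- by rewrite -[0](mulr0 2); apply: cvgM => //; exact: cvg_cst.
- rewrite (_ : (fun j => _) = (fun j => 2^-1 *: ((s j)^-1 *: (g j - 1%:M)))).
    by apply: cvgZr.
  by apply/funext => j; rewrite scalerA invfM.
Qed.

Lemma exponent_midpoint E E' : exponent E -> exponent E' ->
  exponent (2^-1 *: (E + E')).
Proof.
move=> FE FE'; have -> : 2^-1 *: (E + E') = E + 2^-1 *: (E' - E).
  by apply/matrixP => i j; rewrite !mxE; field.
by apply: exponentD => //; apply: tangent_space_half; exact: exponentB.
Qed.

Lemma exponent_conj E g : exponent E -> F 0 g -> exponent (g *m E *m invmx g).
Proof.
move=> FE Fg; have [gu Fgi] := gradedV gF Fg.
apply: graded_exp => // e e0.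
set K := opn g * opn (invmx g) + 1.
have K0 : 0 < K by rewrite ltr_wpDl // mulr_ge0 ?opn_ge0.
have [q q0 hq] := expmx_first_order E (divr_gt0 e0 K0).
set s := Num.min e q / 2.
have s0 : 0 < s by rewrite divr_gt0 // lt_min e0.
have [se sq] : s < e /\ s < q.
  have m0 : 0 < Num.min e q by rewrite lt_min e0.
  have : s < Num.min e q by rewrite /s; lra.
  by rewrite lt_min => /andP.
exists s, (g *m expmx (s *: E) *m invmx g); split.
- have := gradedM gF (gradedM gF Fg (FE s)) Fgi.
  by rewrite add0r oppr0 addr0.
- by rewrite gt_eqF.
- by rewrite gtr0_norm.
have -> : g *m expmx (s *: E) *m invmx g - 1 - s *: (g *m E *m invmx g) =
  g *m (expmx (s *: E) - 1 - s *: E) *m invmx g.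
  rewrite !mulmxBr !mulmxBl mulmx1 mulmxV // -scalemxAr -scalemxAl //.
apply: le_trans (opnM _ _) _.
apply: (@le_trans _ _ (opn g * (e / K * `|s|) * opn (invmx g))).
  rewrite ler_wpM2r ?opn_ge0 //; apply: le_trans (opnM _ _) _.
  by rewrite ler_wpM2l ?opn_ge0 // hq // gtr0_norm.
rewrite [leLHS](_ : _ = (opn g * opn (invmx g)) * (e / K) * `|s|); last by ring.
rewrite ler_wpM2r // mulrCA ler_piMr ?(ltW e0) // ler_pdivrMr // mul1r.
by rewrite /K lerDl.
Qed.

Lemma exponent_closed (u : nat -> 'M[R]_p) E :
  (forall k, exponent (u k)) -> u @ \oo --> E -> exponent E.
Proof.
move=> Fu /cvg_opnP uE; apply: graded_exp => // e e0.
have e20 : 0 < e / 2 by rewrite divr_gt0.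
have [N _ /(_ N (leqnn N)) /= hN] := uE _ e20.
have [q q0 hq] := expmx_first_order (u N) e20.
set s := Num.min e q / 2.
have s0 : 0 < s by rewrite divr_gt0 // lt_min e0.
have [se sq] : s < e /\ s < q.
  have m0 : 0 < Num.min e q by rewrite lt_min e0.
  have : s < Num.min e q by rewrite /s; lra.
  by rewrite lt_min => /andP.
exists s, (expmx (s *: u N)); split.
- exact: Fu.
- by rewrite gt_eqF.
- by rewrite gtr0_norm.
have -> : expmx (s *: u N) - 1 - s *: E =
  (expmx (s *: u N) - 1 - s *: u N) + s *: (u N - E).
  by rewrite scalerBr addrA subrK.
apply: le_trans (opnD _ _) _; rewrite [e in leRHS]splitr mulrDl.
apply: lerD; first by rewrite hq // gtr0_norm.
by apply: le_trans (opnZ _ _) _; rewrite mulrC ler_wpM2r // ltW.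
Qed.

Lemma tangent_space_commutes (G : set 'M[R]_p) E A :
  (forall g, G g -> E *m g = g *m E) -> tangent_space G A -> E *m A = A *m E.
Proof.
move=> hG TA; apply/eqP; rewrite -subr_eq0; apply/eqP.
apply: (@opn_small_eq0 _ _ _ (2 * opn E)) => e e0 _.
have [g [s [Gg s0 _ hg]]] := tangent_space_approx TA e0.
set Y := s^-1 *: (g - 1%:M) in hg.
have EY : E *m Y = Y *m E.
  by rewrite /Y -scalemxAr -scalemxAl mulmxBr mulmxBl hG // mulmx1 mul1mx.
have -> : E *m A - A *m E = (Y - A) *m E - E *m (Y - A).
  by rewrite mulmxBl mulmxBr EY opprB [RHS]addrC subrKA.
apply: le_trans (opnB _ _) _.
have := opnM (Y - A) E; have := opnM E (Y - A).
have := ler_wpM2l (opn_ge0 E) (ltW hg); have := ler_wpM2r (opn_ge0 E) (ltW hg).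
lra.
Qed.

Lemma invmx_mul (g h : 'M[R]_p) : g \in unitmx -> h \in unitmx ->
  invmx (g *m h) = invmx h *m invmx g.
Proof.
move=> gu hu; have ghu : g *m h \in unitmx by rewrite unitmx_mul gu.
apply: (can_inj (mulKmx ghu)).
by rewrite mulmxV // mulmxA mulmxK // mulmxV.
Qed.

(** A fixed point of conjugation by [F 0] on the closed convex set of
    exponents. *)
Lemma central_exponent : (exists E, exponent E) ->
  exists E0, exponent E0 /\ forall B, F 0 B -> E0 *m B = B *m E0.
Proof.
move=> [E FE]; have [c hc] := F0_bounded.
pose Phi : set ('M[R]_p -> 'M[R]_p) :=
  [set f | exists2 g, F 0 g & f = fun x => g *m x *m invmx g].
have [|||||||||E0 FE0 fix0] := @fixed_point_exists R p p Phi exponent (c * c).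
- exists 1; first exact: graded1.
  by apply/funext => x; rewrite /= mul1mx invmx1 mulmx1.
- move=> _ _ [g Fg ->] [h Fh ->]; exists (g * h).
    by have := gradedM gF Fg Fh; rewrite addr0.
  have [gu _] := gradedV gF Fg; have [hu _] := gradedV gF Fh.
  by apply/funext => x /=; rewrite -[g * h]/(g *m h) invmx_mul // !mulmxA.
- move=> _ [g Fg ->]; have [gu Fgi] := gradedV gF Fg; rewrite oppr0 in Fgi.
  exists (fun x => invmx g *m x *m invmx (invmx g)); first by exists (invmx g).
  by move=> x; rewrite invmxK !mulmxA mulVmx // mul1mx mulmxKV.
- move=> _ [g Fg ->] a x y.
  by rewrite mulmxDr mulmxDl -scalemxAr -scalemxAl.
- move=> _ [g Fg ->] x; have [gu Fgi] := gradedV gF Fg; rewrite oppr0 in Fgi.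
  apply: le_trans (opnM _ _) _.
  apply: (@le_trans _ _ (c * opn x * c)); last by rewrite mulrAC.
  apply: ler_pM; rewrite ?opn_ge0 ?hc //.
  apply: le_trans (opnM _ _) _; apply: ler_pM; rewrite ?opn_ge0 ?hc //.
- by exists E.
- by move=> _ x [g Fg ->] Fx; exact: exponent_conj.
- exact: exponent_midpoint.
- exact: exponent_closed.
exists E0; split=> // B FB; have [Bu _] := gradedV gF FB.
have /(_ (fun x => B *m x *m invmx B)) := fix0.
move=> /(_ (ex_intro2 _ _ B FB erefl)) e.
by rewrite -{1}e mulmxKV.
Qed.

Lemma quadratic_form_frob n (x : 'rV[R]_n) : (x *m x^T) 0 0 = frob x.
Proof.
by rewrite mxE /frob big_ord1; apply: eq_bigr => j _; rewrite mxE expr2.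
Qed.

Lemma opn_trmx m n (A : 'M[R]_(m, n)) : opn A^T <= m%:R * opn A.
Proof.
apply: le_trans (opn_le_norm _) _; rewrite ler_wpM2l // (le_trans _ (norm_le_opn A)) //.
by apply: norm_le => // i j; rewrite mxE entry_le_norm.
Qed.

Lemma frob_mulmx_le m n k (x : 'M[R]_(m, n)) (B : 'M[R]_(n, k)) (c : R) :
  opn B <= c -> frob (x *m B) <= (frob_const R m k * c * frob_const R m n) ^+ 2 * frob x.
Proof.
move=> Bc; have c0 : 0 <= c := le_trans (opn_ge0 B) Bc.
have k1 := ltW (frob_const_gt0 R m k); have k2 := ltW (frob_const_gt0 R m n).
apply: le_trans (frob_le_opn _) _.
apply: (@le_trans _ _ ((frob_const R m k * (frob_const R m n * Num.sqrt (frob x) * c)) ^+ 2)).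
  rewrite lerXn2r ?nnegrE ?mulr_ge0 ?opn_ge0 ?sqrtr_ge0 //.
  rewrite ler_wpM2l // (le_trans (opnM _ _)) //.
  by apply: ler_pM; rewrite ?opn_ge0 ?opn_le_frob.
rewrite [leLHS](_ : _ = (frob_const R m k * c * frob_const R m n) ^+ 2
  * Num.sqrt (frob x) ^+ 2); last by ring.
by rewrite sqr_sqrtr ?frob_ge0.
Qed.

(** A fixed point of congruence by [F 0] on the forms whose whole orbit is bounded
    below by a multiple of the standard form.  The standard form is one of them,
    because the inverses of the elements of [F 0] are bounded. *)
Lemma invariant_form : exists W : 'M[R]_p,
  (forall x : 'rV[R]_p, x != 0 -> 0 < (x *m W *m x^T) 0 0) /\
  (forall g, F 0 g -> g *m W *m g^T = W).
Proof.
have [c hc] := F0_bounded.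
have c0 : 0 <= c := le_trans (opn_ge0 1) (hc _ (graded1 gF)).
pose Phi : set ('M[R]_p -> 'M[R]_p) :=
  [set f | exists2 g, F 0 g & f = fun x => g *m x *m g^T].
pose K := (frob_const R 1 p * c * frob_const R 1 p) ^+ 2 + 1.
have K0 : 0 < K by rewrite ltr_wpDl // sqr_ge0.
pose v (g W : 'M[R]_p) (x : 'rV[R]_p) := (x *m (g *m W *m g^T) *m x^T) 0 0.
pose S : set 'M[R]_p := [set W | forall g x, F 0 g -> frob x <= K * v g W x].
have F0M g h : F 0 g -> F 0 h -> F 0 (g *m h).
  by move=> Fg Fh; have := gradedM gF Fg Fh; rewrite addr0.
have F0V g : F 0 g -> F 0 (invmx g).
  by move=> Fg; have [_] := gradedV gF Fg; rewrite oppr0.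
have [|||||||||W SW fixW] := @fixed_point_exists R p p Phi S (c * (p%:R * c)).
- exists 1; first exact: graded1.
  by apply/funext => x; rewrite /= mul1mx trmx1 mulmx1.
- move=> _ _ [g Fg ->] [h Fh ->]; exists (g *m h); first exact: F0M.
  by apply/funext => x /=; rewrite trmx_mul !mulmxA.
- move=> _ [g Fg ->]; have [gu _] := gradedV gF Fg.
  exists (fun x => invmx g *m x *m (invmx g)^T); first by exists (invmx g) => //; exact: F0V.
  move=> x; rewrite !mulmxA mulVmx // mul1mx -mulmxA -trmx_mul mulVmx //.
  by rewrite trmx1 mulmx1.
- move=> _ [g Fg ->] a x y.
  by rewrite mulmxDr mulmxDl -scalemxAr -scalemxAl.
- move=> _ [g Fg ->] x; apply: le_trans (opnM _ _) _.
  apply: (@le_trans _ _ (c * opn x * (p%:R * c))); last by rewrite mulrAC.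
  apply: ler_pM; rewrite ?opn_ge0 //.
    by apply: le_trans (opnM _ _) _; apply: ler_pM; rewrite ?opn_ge0 ?hc.
  by apply: le_trans (opn_trmx _) _; rewrite ler_wpM2l // hc.
- exists 1 => g x Fg; have [gu _] := gradedV gF Fg.
  rewrite /v mulmx1 mulmxA -mulmxA -trmx_mul quadratic_form_frob.
  rewrite -{1}(mulmxK gu x); apply: le_trans (frob_mulmx_le _ (hc _ (F0V _ Fg))) _.
  by rewrite ler_wpM2r ?frob_ge0 // /K lerDl.
- move=> _ W [h Fh ->] SW g x Fg.
  have := SW (g *m h) x (F0M _ _ Fg Fh).
  by rewrite /v trmx_mul !mulmxA.
- move=> W W' SW SW' g x Fg; have := SW g x Fg; have := SW' g x Fg.
  suff -> : v g (2^-1 *: (W + W')) x = 2^-1 * (v g W x + v g W' x) by lra.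
  rewrite /v -scalemxAr -scalemxAl -scalemxAr -scalemxAl mxE; congr (_ * _).
  by rewrite mulmxDr mulmxDl mulmxDr mulmxDl mxE.
- move=> u W Su /cvg_opnP uW g x Fg; apply/ler_addgt0Pr => e e0.
  pose L := K * (opn (x *m g) * opn (g^T *m x^T)) + 1.
  have L0 : 0 < L by rewrite ltr_wpDl // !mulr_ge0 ?opn_ge0 ?(ltW K0).
  have [N _ /(_ N (leqnn N)) /= hN] := uW _ (divr_gt0 e0 L0).
  apply: le_trans (Su N g x Fg) _.
  have vB : v g (u N) x - v g W x <= opn (x *m g) * opn (u N - W) * opn (g^T *m x^T).
    have -> : v g (u N) x - v g W x = (x *m g *m (u N - W) *m (g^T *m x^T)) 0 0.
      by rewrite mulmxBr mulmxBl [RHS]mxE [X in _ = _ + X]mxE /v !mulmxA.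
    apply: le_trans (ler_norm _) _; apply: le_trans (entry_le_opn _ _ _) _.
    apply: le_trans (opnM _ _) _; rewrite ler_wpM2r ?opn_ge0 //.
    exact: opnM.
  have : K * (v g (u N) x - v g W x) <= e.
    apply: le_trans (ler_wpM2l (ltW K0) vB) _.
    move: hN; rewrite ltr_pdivlMr // => /ltW; apply: le_trans.
    rewrite [leLHS](_ : _ = opn (u N - W) * (L - 1)); last by rewrite /L; ring.
    by rewrite ler_wpM2l ?opn_ge0 // lerBlDr lerDl.
  lra.
exists W; split=> [x x0|g Fg]; last first.
  exact: (fixW _ (ex_intro2 _ _ g Fg erefl)).
have := SW 1 x (graded1 gF); rewrite /v mul1mx trmx1 mulmx1.
have x1 : 0 < frob x.
  have [i xi] : exists i, x 0 i != 0.
    apply/existsP; apply: contraT; rewrite negb_exists => /forallP h.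
    case/eqP: x0; apply/rowP => i; rewrite mxE; apply/eqP.
    by have := h i; rewrite negbK.
  rewrite /frob big_ord1 (bigD1 i) //= ltr_pwDl //.
    by rewrite lt_neqAle sqr_ge0 eq_sym sqrf_eq0 xi.
  by apply: sumr_ge0 => j _; exact: sqr_ge0.
by move=> /(lt_le_trans x1); rewrite pmulr_rgt0.
Qed.

(** Differentiate [g W g^T = W] at the unit. *)
Lemma tangent_space_skew (W : 'M[R]_p) A :
  (forall g, F 0 g -> g *m W *m g^T = W) -> tangent_space (F 0) A ->
  A *m W + W *m A^T = 0.
Proof.
move=> hW TA; pose a := opn A + 1; pose w := opn W.
have a0 : 0 <= a by rewrite addr_ge0 ?opn_ge0.
have w0 : 0 <= w := opn_ge0 W.
apply: (@opn_small_eq0 _ _ _ (w + w * p%:R + a * w * (p%:R * a))) => e e0 e1.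
have [g [s [Gg s0 se hg]]] := tangent_space_approx TA e0.
set Y := s^-1 *: (g - 1%:M) in hg.
have gY : g = 1%:M + s *: Y by rewrite /Y scalerA divff // scale1r subrKC.
have Ya : opn Y <= a.
  by rewrite -(subrK A Y); apply: le_trans (opnD _ _) _; rewrite /a; lra.
have eq0 : Y *m W + W *m Y^T + s *: (Y *m W *m Y^T) = 0.
  have gT : (1%:M + s *: Y)^T = 1%:M + s *: Y^T.
    by rewrite linearD /= trmx1 linearZ.
  have gWg : g *m W *m g^T = W + s *: (Y *m W + W *m Y^T + s *: (Y *m W *m Y^T)).
    rewrite gY gT mulmxDl mul1mx mulmxDr mulmx1 mulmxDl.
    by rewrite -!scalemxAr -!scalemxAl !scalerDr !addrA.
  have /eqP : s *: (Y *m W + W *m Y^T + s *: (Y *m W *m Y^T)) = 0.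
    by apply: (@addrI _ W); rewrite -gWg hW // addr0.
  by rewrite scaler_eq0 (negPf s0) => /eqP.
have -> : A *m W + W *m A^T =
   - ((Y - A) *m W + W *m (Y - A)^T + s *: (Y *m W *m Y^T)).
  have -> : s *: (Y *m W *m Y^T) = - (Y *m W + W *m Y^T).
    by apply/eqP; rewrite -addr_eq0 addrC eq0.
  rewrite [(Y - A)^T]linearB /= mulmxBl mulmxBr addrACA [X in - X]addrAC subrr add0r.
  by rewrite opprD !opprK.
rewrite opnN; apply: le_trans (opnD _ _) _.
have i1 : opn ((Y - A) *m W) <= w * e.
  by apply: le_trans (opnM _ _) _; rewrite mulrC ler_wpM2l // ltW.
have i2 : opn (W *m (Y - A)^T) <= w * p%:R * e.
  apply: le_trans (opnM _ _) _; rewrite -mulrA ler_wpM2l //.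
  by apply: le_trans (opn_trmx _) _; rewrite ler_wpM2l // ltW.
have i3 : opn (s *: (Y *m W *m Y^T)) <= a * w * (p%:R * a) * e.
  apply: le_trans (opnZ _ _) _; rewrite mulrC.
  apply: ler_pM => //; [exact: opn_ge0 | | exact: ltW].
  apply: le_trans (opnM _ _) _; apply: ler_pM; rewrite ?opn_ge0 //.
    by apply: le_trans (opnM _ _) _; apply: ler_pM; rewrite ?opn_ge0.
  by apply: le_trans (opn_trmx _) _; rewrite ler_wpM2l.
have := opnD ((Y - A) *m W) (W *m (Y - A)^T); lra.
Qed.

Lemma tangent_semisimple A : tangent_space (F 0) A -> semisimplemx A.
Proof.
move=> TA; have [W [Wpos hW]] := invariant_form.
exact: skew_semisimple Wpos (tangent_space_skew hW TA).
Qed.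

Lemma tangent_eigenvalue_Re0 A z : tangent_space (F 0) A ->
  eigenvalue (complexmx A) z -> complex.Re z = 0.
Proof.
move=> TA; have [W [Wpos hW]] := invariant_form.
exact: skew_eigenvalue_Re0 Wpos (tangent_space_skew hW TA) z.
Qed.

End Exponents.

(** * Spectra of exponents *)

Section RealSpectrum.
Variable R : realType.

(** A common eigenvector of [E + A] and [A] is an eigenvector of [E], for an
    eigenvalue with the same real part. *)
Lemma real_spectrum_addl p (E A : 'M[R]_p) : E *m A = A *m E ->
  (forall z, eigenvalue (complexmx A) z -> complex.Re z = 0) ->
  real_spectrum (E + A) `<=` real_spectrum E.
Proof.
move=> EA hA x [z Ez <-].
have com : complexmx (E + A) *m complexmx A = complexmx A *m complexmx (E + A).
  by rewrite /complexmx -!complexmxM mulmxDl mulmxDr EA.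
have [v [w [v0 vz vw]]] := eigenvalue_common_eigenvector com Ez.
have w0 : complex.Re w = 0 by apply: hA; apply/eigenvalueP; exists v.
exists (z - w); last first.
  by move: w0; case: (z) (w) => [a b] [a' b'] /= ->; rewrite subr0.
apply/eigenvalueP; exists v => //.
by move: vz; rewrite complexmxD mulmxDr vw scalerBl => <-; rewrite addrK.
Qed.

End RealSpectrum.

Theorem theorem2p5 (R : realType) (d : measure_display) (T : measurableType d)
    (P : probability T R) (m n : nat) (X : 'cV[R]_m -> T -> 'cV[R]_n)
    (H : 'M[R]_n) (hX : exists E : 'M[R]_m, oss P X E H) :
  [/\ forall E, domain_exponents P X H E ->
        domain_exponents P X H =
        [set E + A | A in tangent_space (domain_symmetries P X)],
      exists E0, domain_exponents P X H E0 /\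
        (forall B, domain_symmetries P X B -> E0 *m B = B *m E0),
      exists N, (forall E, domain_exponents P X H E ->
                   nilpotent_part E = [set N]) /\
        (forall B, domain_symmetries P X B -> N *m B = B *m N) &
      forall E E', domain_exponents P X H E -> domain_exponents P X H E' ->
        real_spectrum E = real_spectrum E'].
Proof.
have [E1 [[mX pX ndX cX] [hE1 hH E1H]]] := hX.
pose F := scaling_group P X H.
have gF : closed_graded_group F by exact: scaling_group_graded.
have expP E : domain_exponents P X H E <-> exponent F E by exact: domain_exponentsP.
have symE : domain_symmetries P X = F 0 by rewrite -(scaling_group0E P X H).
have bF : exists c, forall B, F 0 B -> opn B <= c.
  have [c hc] := domain_symmetries_bounded mX pX ndX cX hE1 hH E1H.
  by exists c => B; rewrite -symE; exact: hc.
have [E0 [FE0 central]] := central_exponent gF bF (ex_intro _ E1 ((expP E1).1 E1H)).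
have diff0 E : exponent F E -> exists A,
    [/\ E = E0 + A, tangent_space (F 0) A & E0 *m A = A *m E0].
  move=> FE; have TA := exponentB gF FE0 FE; exists (E - E0); split=> //.
    by rewrite subrKC.
  exact: tangent_space_commutes central TA.
have spec E : exponent F E -> real_spectrum E = real_spectrum E0.
  move=> /diff0[A [-> TA E0A]].
  have imA z := tangent_eigenvalue_Re0 gF bF (z := z) TA.
  apply/seteqP; split; first exact: real_spectrum_addl.
  rewrite -{1}(addrK A E0); apply: real_spectrum_addl.
    by rewrite mulmxN mulNmx mulmxDl mulmxDr E0A.
  move=> z; rewrite -(opprK z) => /eigenvalueP[v vA v0].
  have /imA : eigenvalue (complexmx A) (- z).
    apply/eigenvalueP; exists v => //.
    move: vA; rewrite /complexmx map_mxN mulmxN opprK => /eqP.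
    by rewrite eqr_oppLR scaleNr => /eqP.
  by case: (z) => a b /= ->; rewrite oppr0.
rewrite symE; split.
- move=> E /expP FE; apply/seteqP; split=> [E' /expP FE'|_ [A TA <-]].
    by exists (E' - E); [exact: exponentB | rewrite subrKC].
  by apply/expP; exact: exponentD.
- by exists E0; split=> //; apply/expP.
- have [N [nilE0 comN]] := nilpotent_part_unique E0.
  exists N; split; last by move=> B /central; exact: comN.
  move=> E /expP/diff0[A [EA TA E0A]].
  have [N' [nilE _]] := nilpotent_part_unique E.
  suff : nilpotent_part E N by rewrite nilE => ->.
  have [S [E0SN ssS nilN SN]] : nilpotent_part E0 N by rewrite nilE0.
  have NA := comN A E0A.
  have SA : S *m A = A *m S.
    have SE : S = E0 - N by rewrite E0SN addrK.
    by rewrite SE mulmxBl mulmxBr E0A NA.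
  have SAC : complexmx S *m complexmx A = complexmx A *m complexmx S.
    by rewrite /complexmx -!complexmxM SA.
  have ssSA := diagonalizableD SAC ssS (tangent_semisimple gF bF TA).
  rewrite -complexmxD in ssSA.
  (* As [S], [N] and [A] commute, [(S + A) + N] is the decomposition of [E]. *)
  exists (S + A); split; [|exact: ssSA|exact: nilN|].
    by rewrite EA E0SN addrAC.
  by rewrite mulmxDl mulmxDr SN NA.
- by move=> E E' /expP/spec -> /expP/spec ->.
Qed.
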